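(* Let $\mathcal L$ be a semilattice and let $(A_i)_{i\in\mathcal L}$ be a family of $C^*$-algebras. Suppose given, for all $i,j\in\mathcal L$ with $i\le j$, a morphism $\varphi_{i,j}:A_j\to M(A_i)$, such that: (a) $\varphi_{i,i}=\mathrm{Id}_{A_i}$ (i.e. $\varphi_{i,i}$ is the canonical inclusion $A_i\subset M(A_i)$) for all $i\in\mathcal L$; (b) for all $i,j\in\mathcal L$, with $k=i\wedge j$, all $m\in\mathcal L$ with $m\le k$, and all $x\in A_i$, $y\in A_j$, $$\varphi_{k,i}(x)\varphi_{k,j}(y)\in A_k\quad\text{and}\quad \varphi_{m,k}\big(\varphi_{k,i}(x)\varphi_{k,j}(y)\big)=\varphi_{m,i}(x)\varphi_{m,j}(y).$$ Then there exists, up to isomorphism, a unique $\mathcal L$-graded $C^*$-algebra $(\mathfrak A,(A_i)_{i\in\mathcal L})$ whose structure morphisms are the $\varphi_{i,j}$.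
   Context: A semilattice is a partially ordered set $\mathcal L$ in which any two elements $k,\ell$ have a greatest lower bound $k\wedge\ell$. A $C^*$-algebra $\mathfrak A$ is $\mathcal L$-graded with components $(A_i)_{i\in\mathcal L}$, written $(\mathfrak A,(A_i)_{i\in\mathcal L})$, if $(A_i)_{i\in\mathcal L}$ is a family of sub-$C^*$-algebras of $\mathfrak A$ which is linearly independent (if $S_i\in A_i$, only finitely many $S_i$ are nonzero and $\sum_i S_i=0$, then all $S_i=0$), total (the linear span of $\bigcup_i A_i$ is dense in $\mathfrak A$), and satisfies $A_iA_j\subset A_{i\wedge j}$ for all $i,j\in\mathcal L$. $M(A)$ denotes the multiplier algebra of a $C^*$-algebra $A$, and $A$ is identified with its canonical image in $M(A)$. For an $\mathcal L$-graded $C^*$-algebra and $i\le j$, we have $A_jA_i\subset A_i$, and the structure morphism $\varphi_{i,j}:A_j\to M(A_i)$ is defined by $\varphi_{i,j}(y)x=yx$ for $x\in A_i$, $y\in A_j$. Morphisms of $C^*$-algebras are $*$-homomorphisms. Saying that a graded algebra has components the given $A_i$ means that each $A_i$ is identified with the corresponding sub-$C^*$-algebra via an isomorphism, compatibly with the structure morphisms. *)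

(* Defs.v *)
From HB Require Import structures.
From mathcomp Require Import all_boot all_order all_algebra.
From mathcomp Require Import complex.
From mathcomp Require Import all_classical all_reals all_analysis.

Set Implicit Arguments.
Unset Strict Implicit.
Unset Printing Implicit Defensive.

Import Order.TTheory GRing.Theory Num.Theory.
Import numFieldNormedType.Exports.

Local Open Scope classical_set_scope.
Local Open Scope ring_scope.

(* The algebras are not assumed unital, so their product cannot be the one of
   [pzRingType]: it is written [x ** y]. *)
HB.mixin Record Lmodule_isStarAlg (K : numClosedFieldType) A
    of GRing.Lmodule K A := {
  smul : A -> A -> A;
  star : A -> A;
  smulA : associative smul;
  smulDl : left_distributive smul +%R;
  smulDr : right_distributive smul +%R;
  scalersAl : forall (a : K) (x y : A), a *: smul x y = smul (a *: x) y;
  scalersAr : forall (a : K) (x y : A), a *: smul x y = smul x (a *: y);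
  starK : involutive star;
  starD : {morph star : x y / x + y};
  starZ : forall (a : K) (x : A), star (a *: x) = (a^* : K) *: star x;
  starM : forall x y : A, star (smul x y) = smul (star y) (star x)
}.

#[short(type="starAlgType")]
HB.structure Definition StarAlg (K : numClosedFieldType) :=
  {A of Lmodule_isStarAlg K A & GRing.Lmodule K A}.

Notation "x ** y" := (smul x y) (at level 40, left associativity) : ring_scope.

HB.mixin Record NormedStarAlg_isCStarAlg (R : realType) A
    of CompleteNormedModule R[i] A & StarAlg R[i] A := {
  normsM : forall x y : A, `|x ** y| <= `|x| * `|y|;
  normCstar : forall x : A, `|star x ** x| = `|x| ^+ 2
}.

#[short(type="cstarAlgType")]
HB.structure Definition CStarAlg (R : realType) :=
  {A of NormedStarAlg_isCStarAlg R A & CompleteNormedModule R[i] A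
      & StarAlg R[i] A}.

Definition star_hom (K : numClosedFieldType) (A B : starAlgType K)
    (f : A -> B) : Prop :=
  [/\ linear f, {morph f : x y / x ** y} & {morph f : x / star x}].

Section Multiplier.
#[local] Obligation Tactic := idtac.
Context {R : realType} (A : cstarAlgType R).

Definition bounded_operator (f : A -> A) : Prop :=
  exists M : R[i], forall x, `|f x| <= M * `|x|.

(* Elements of M(A), as double centralisers: [lmult m x] is m x and
   [rmult m x] is x m. *)
Record multiplier : Type := Multiplier {
  lmult : A -> A;
  rmult : A -> A;
  lmult_linear : linear lmult;
  rmult_linear : linear rmult;
  lmult_bounded : bounded_operator lmult;
  rmult_bounded : bounded_operator rmult;
  lmultM : forall x y, lmult (x ** y) = lmult x ** y;
  rmultM : forall x y, rmult (x ** y) = x ** rmult y;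
  rmult_lmult : forall x y, rmult x ** y = x ** lmult y
}.

Lemma multiplier_ext (m n : multiplier) :
  lmult m =1 lmult n -> rmult m =1 rmult n -> m = n.
Proof.
case: m n => l r ? ? ? ? ? ? ? [l' r' ? ? ? ? ? ? ?] /= /funext el /funext er.
by subst l' r'; f_equal; exact: Prop_irrelevance.
Qed.

HB.instance Definition _ := gen_eqMixin multiplier.
HB.instance Definition _ := gen_choiceMixin multiplier.

Lemma smul0r (x : A) : 0 ** x = 0.
Proof. by apply: (@addIr _ (0 ** x)); rewrite -smulDl !add0r. Qed.

Lemma smulr0 (x : A) : x ** 0 = 0.
Proof. by apply: (@addIr _ (x ** 0)); rewrite -smulDr !add0r. Qed.

Lemma star0 : star (0 : A) = 0.
Proof. by apply: (@addIr _ (star 0)); rewrite -starD !add0r. Qed.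

Lemma norm_le_star (x : A) : `|x| <= `|star x|.
Proof.
have [->|x0] := eqVneq x 0; first by rewrite normr0.
have nx : 0 < `|x| by rewrite normr_gt0.
by rewrite -(ler_pM2r nx) -expr2 -normCstar normsM.
Qed.

Lemma norm_star (x : A) : `|star x| = `|x|.
Proof.
by apply/eqP; rewrite eq_le norm_le_star -{2}(starK x) norm_le_star.
Qed.

Lemma bounded_operator_ge0 (f : A -> A) : bounded_operator f ->
  exists2 M : R[i], 0 <= M & forall x, `|f x| <= M * `|x|.
Proof.
move=> [M fM].
have [[x /eqP x0]|/forallNP all0] := pselect (exists x : A, x <> 0); last first.
  exists 0 => // x; have /contrapT -> := all0 x.
  have /contrapT -> := all0 (f 0).
  by rewrite normr0 mulr0.
exists M => //.
have nx : 0 < `|x| by rewrite normr_gt0.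
by rewrite -(pmulr_lge0 _ nx); exact: le_trans (fM x).
Qed.

Lemma bounded_operatorD (f g : A -> A) :
  bounded_operator f -> bounded_operator g ->
  bounded_operator (fun x => f x + g x).
Proof.
move=> [M fM] [N gN]; exists (M + N) => x.
by rewrite mulrDl (le_trans (ler_normD _ _))// lerD.
Qed.

Lemma bounded_operatorZ (a : R[i]) (f : A -> A) :
  bounded_operator f -> bounded_operator (fun x => a *: f x).
Proof.
move=> [M fM]; exists (`|a| * M) => x.
by rewrite normrZ -mulrA ler_wpM2l.
Qed.

Lemma bounded_operator_comp (f g : A -> A) :
  bounded_operator f -> bounded_operator g -> bounded_operator (f \o g).
Proof.
move=> /bounded_operator_ge0[M M0 fM] [N gN]; exists (M * N) => x /=.
by rewrite (le_trans (fM _))// -mulrA ler_wpM2l.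
Qed.

Lemma bounded_operator_star (f : A -> A) :
  bounded_operator f -> bounded_operator (fun x => star (f (star x))).
Proof.
by move=> [M fM]; exists M => x; rewrite norm_star -[X in _ * X]norm_star.
Qed.

Lemma linear_star_conj (f : A -> A) :
  linear f -> linear (fun x => star (f (star x))).
Proof. by move=> lf a x y; rewrite starD starZ lf starD starZ conjCK. Qed.

Program Definition mult_zero : multiplier :=
  @Multiplier (fun=> 0) (fun=> 0) _ _ _ _ _ _ _.
Next Obligation. by move=> a x y /=; rewrite scaler0 addr0. Qed.
Next Obligation. by move=> a x y /=; rewrite scaler0 addr0. Qed.
Next Obligation. by exists 0 => x; rewrite normr0 mul0r. Qed.
Next Obligation. by exists 0 => x; rewrite normr0 mul0r. Qed.
Next Obligation. by move=> x y /=; rewrite smul0r. Qed.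
Next Obligation. by move=> x y /=; rewrite smulr0. Qed.
Next Obligation. by move=> x y /=; rewrite smul0r smulr0. Qed.

Program Definition mult_add (m n : multiplier) : multiplier :=
  @Multiplier (fun x => lmult m x + lmult n x)
    (fun x => rmult m x + rmult n x) _ _ _ _ _ _ _.
Next Obligation.
by move=> m n a x y /=; rewrite !lmult_linear scalerDr addrACA.
Qed.
Next Obligation.
by move=> m n a x y /=; rewrite !rmult_linear scalerDr addrACA.
Qed.
Next Obligation.
by move=> m n /=; apply: bounded_operatorD; exact: lmult_bounded.
Qed.
Next Obligation.
by move=> m n /=; apply: bounded_operatorD; exact: rmult_bounded.
Qed.
Next Obligation. by move=> m n x y /=; rewrite !lmultM smulDl. Qed.
Next Obligation. by move=> m n x y /=; rewrite !rmultM smulDr. Qed.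
Next Obligation. by move=> m n x y /=; rewrite smulDl smulDr !rmult_lmult. Qed.

Program Definition mult_scale (b : R[i]) (m : multiplier) : multiplier :=
  @Multiplier (fun x => b *: lmult m x) (fun x => b *: rmult m x)
    _ _ _ _ _ _ _.
Next Obligation.
by move=> b m a x y /=; rewrite lmult_linear scalerDr !scalerA mulrC.
Qed.
Next Obligation.
by move=> b m a x y /=; rewrite rmult_linear scalerDr !scalerA mulrC.
Qed.
Next Obligation. by move=> b m /=; exact/bounded_operatorZ/lmult_bounded. Qed.
Next Obligation. by move=> b m /=; exact/bounded_operatorZ/rmult_bounded. Qed.
Next Obligation. by move=> b m x y /=; rewrite lmultM scalersAl. Qed.
Next Obligation. by move=> b m x y /=; rewrite rmultM scalersAr. Qed.
Next Obligation.
by move=> b m x y /=; rewrite -scalersAl -scalersAr rmult_lmult.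
Qed.

Definition mult_opp (m : multiplier) : multiplier := mult_scale (-1) m.

(* The product reverses the order on the right-multiplication side. *)
Program Definition mult_mul (m n : multiplier) : multiplier :=
  @Multiplier (lmult m \o lmult n) (rmult n \o rmult m) _ _ _ _ _ _ _.
Next Obligation. by move=> m n a x y /=; rewrite !lmult_linear. Qed.
Next Obligation. by move=> m n a x y /=; rewrite !rmult_linear. Qed.
Next Obligation.
by move=> m n /=; apply: bounded_operator_comp; exact: lmult_bounded.
Qed.
Next Obligation.
by move=> m n /=; apply: bounded_operator_comp; exact: rmult_bounded.
Qed.
Next Obligation. by move=> m n x y /=; rewrite !lmultM. Qed.
Next Obligation. by move=> m n x y /=; rewrite !rmultM. Qed.
Next Obligation. by move=> m n x y /=; rewrite !rmult_lmult. Qed.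

(* The adjoint exchanges the two sides: m^* x = (x^* m)^*. *)
Program Definition mult_star (m : multiplier) : multiplier :=
  @Multiplier (fun x => star (rmult m (star x)))
    (fun x => star (lmult m (star x))) _ _ _ _ _ _ _.
Next Obligation. by move=> m /=; exact/linear_star_conj/rmult_linear. Qed.
Next Obligation. by move=> m /=; exact/linear_star_conj/lmult_linear. Qed.
Next Obligation. by move=> m /=; exact/bounded_operator_star/rmult_bounded. Qed.
Next Obligation. by move=> m /=; exact/bounded_operator_star/lmult_bounded. Qed.
Next Obligation. by move=> m x y /=; rewrite starM rmultM starM starK. Qed.
Next Obligation. by move=> m x y /=; rewrite starM lmultM starM starK. Qed.
Next Obligation.
move=> m x y /=; apply: (can_inj (@starK _ A)).
by rewrite !starM !starK rmult_lmult.
Qed.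

Lemma mult_addA : associative mult_add.
Proof. by move=> m n p; apply: multiplier_ext => x /=; rewrite addrA. Qed.

Lemma mult_addC : commutative mult_add.
Proof. by move=> m n; apply: multiplier_ext => x /=; rewrite addrC. Qed.

Lemma mult_add0 : left_id mult_zero mult_add.
Proof. by move=> m; apply: multiplier_ext => x /=; rewrite add0r. Qed.

Lemma mult_addN : left_inverse mult_zero mult_opp mult_add.
Proof.
by move=> m; apply: multiplier_ext => x /=; rewrite scaleN1r addNr.
Qed.

HB.instance Definition _ :=
  GRing.isZmodule.Build multiplier mult_addA mult_addC mult_add0 mult_addN.

Lemma mult_scaleA a b m : mult_scale a (mult_scale b m) = mult_scale (a * b) m.
Proof. by apply: multiplier_ext => x /=; rewrite scalerA. Qed.

Lemma mult_scale1 : left_id 1 mult_scale.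
Proof. by move=> m; apply: multiplier_ext => x /=; rewrite scale1r. Qed.

Lemma mult_scaleDr : right_distributive mult_scale +%R.
Proof. by move=> a m n; apply: multiplier_ext => x /=; rewrite scalerDr. Qed.

Lemma mult_scaleDl m : {morph mult_scale^~ m : a b / a + b}.
Proof. by move=> a b; apply: multiplier_ext => x /=; rewrite scalerDl. Qed.

HB.instance Definition _ :=
  GRing.Zmodule_isLmodule.Build R[i] multiplier
    mult_scaleA mult_scale1 mult_scaleDr mult_scaleDl.

Lemma lmultD m : {morph lmult m : x y / x + y}.
Proof. by move=> x y; rewrite -[x]scale1r lmult_linear !scale1r. Qed.

Lemma rmultD m : {morph rmult m : x y / x + y}.
Proof. by move=> x y; rewrite -[x]scale1r rmult_linear !scale1r. Qed.

Lemma lmultZ m a x : lmult m (a *: x) = a *: lmult m x.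
Proof.
have m0 : lmult m 0 = 0.
  by apply: (@addIr _ (lmult m 0)); rewrite -lmultD !add0r.
by rewrite -[a *: x]addr0 lmult_linear m0 addr0.
Qed.

Lemma rmultZ m a x : rmult m (a *: x) = a *: rmult m x.
Proof.
have m0 : rmult m 0 = 0.
  by apply: (@addIr _ (rmult m 0)); rewrite -rmultD !add0r.
by rewrite -[a *: x]addr0 rmult_linear m0 addr0.
Qed.

Lemma mult_mulA : associative mult_mul.
Proof. by move=> m n p; exact: multiplier_ext. Qed.

Lemma mult_mulDl : left_distributive mult_mul +%R.
Proof. by move=> m n p; apply: multiplier_ext => x //=; rewrite rmultD. Qed.

Lemma mult_mulDr : right_distributive mult_mul +%R.
Proof. by move=> m n p; apply: multiplier_ext => x //=; rewrite lmultD. Qed.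

Lemma mult_scaleAl (a : R[i]) (m n : multiplier) :
  a *: mult_mul m n = mult_mul (a *: m) n.
Proof. by apply: multiplier_ext => x //=; rewrite rmultZ. Qed.

Lemma mult_scaleAr (a : R[i]) (m n : multiplier) :
  a *: mult_mul m n = mult_mul m (a *: n).
Proof. by apply: multiplier_ext => x //=; rewrite lmultZ. Qed.

Lemma mult_starK : involutive mult_star.
Proof. by move=> m; apply: multiplier_ext => x /=; rewrite !starK. Qed.

Lemma mult_starD : {morph mult_star : m n / m + n}.
Proof. by move=> m n; apply: multiplier_ext => x /=; rewrite starD. Qed.

Lemma mult_starZ (a : R[i]) (m : multiplier) :
  mult_star (a *: m) = (a^* : R[i]) *: mult_star m.
Proof. by apply: multiplier_ext => x /=; rewrite starZ. Qed.

Lemma mult_starM m n :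
  mult_star (mult_mul m n) = mult_mul (mult_star n) (mult_star m).
Proof. by apply: multiplier_ext => x /=; rewrite starK. Qed.

HB.instance Definition _ :=
  Lmodule_isStarAlg.Build R[i] multiplier mult_mulA mult_mulDl mult_mulDr
    mult_scaleAl mult_scaleAr mult_starK mult_starD mult_starZ mult_starM.

(* The canonical inclusion of A in M(A). *)
Program Definition mult_incl (a : A) : multiplier :=
  @Multiplier (fun x => a ** x) (fun x => x ** a) _ _ _ _ _ _ _.
Next Obligation. by move=> a b x y /=; rewrite smulDr scalersAr. Qed.
Next Obligation. by move=> a b x y /=; rewrite smulDl scalersAl. Qed.
Next Obligation. by move=> a /=; exists `|a| => x; exact: normsM. Qed.
Next Obligation.
by move=> a /=; exists `|a| => x; rewrite mulrC; exact: normsM.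
Qed.
Next Obligation. by move=> a x y /=; rewrite smulA. Qed.
Next Obligation. by move=> a x y /=; rewrite smulA. Qed.
Next Obligation. by move=> a x y /=; rewrite smulA. Qed.

End Multiplier.

(* In M(A), with A identified with its image, the product of m and x in A is
   [lmult m x]. *)
Lemma mult_mul_incl (R : realType) (A : cstarAlgType R) (m : multiplier A)
  (x : A) : m ** mult_incl x = mult_incl (lmult m x).
Proof.
apply: multiplier_ext => y; first exact: lmultM.
exact: rmult_lmult.
Qed.

Definition linear_span (K : numFieldType) (V : lmodType K) (S : set V) :
    set V :=
  [set x | exists n (c : 'I_n -> K) (v : 'I_n -> V),
     (forall k, S (v k)) /\ x = \sum_(k < n) c k *: v k].

Record sub_cstar (R : realType) (A : cstarAlgType R) (B : set A) : Prop := {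
  sub_cstar_closed : closed B;
  sub_cstar0 : B 0;
  sub_cstarD : forall x y, B x -> B y -> B (x + y);
  sub_cstarZ : forall (a : R[i]) x, B x -> B (a *: x);
  sub_cstarM : forall x y, B x -> B y -> B (x ** y);
  sub_cstar_star : forall x, B x -> B (star x)
}.

Record gradedCStarAlg (R : realType) (d : Order.disp_t)
    (L : meetSemilatticeType d) : Type := GradedCStarAlg {
  graded_alg :> cstarAlgType R;
  component : L -> set graded_alg;
  component_sub : forall i, sub_cstar (component i);
  component_indep : forall S : L -> graded_alg,
    (forall i, component i (S i)) -> finite_set [set i | S i != 0] ->
    \sum_(i \in [set: L]) S i = 0 -> forall i, S i = 0;
  component_total : dense (linear_span (\bigcup_i component i));
  component_mul : forall i j x y, component i x -> component j y ->
    component (i `&` j)%O (x ** y)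
}.

Arguments component {R d L} G i : rename.

(* Identification of the components of [G] with given C*-algebras [A i]. *)
Record identification (R : realType) (d : Order.disp_t)
    (L : meetSemilatticeType d) (A : L -> cstarAlgType R)
    (G : gradedCStarAlg R L) : Type := Identification {
  emb :> forall i, A i -> G;
  emb_hom : forall i, star_hom (@emb i);
  emb_inj : forall i, injective (@emb i);
  emb_range : forall i, range (@emb i) = component G i
}.
Arguments emb {R d L A G} _ i _.

(* The structure morphism A_j -> M(A_i) of a graded C*-algebra is determined
   by phi(y) x = y x for x in A_i and y in A_j, the product y x being taken in
   the graded algebra. *)
Definition structure_morphisms (R : realType) (d : Order.disp_t)
    (L : meetSemilatticeType d) (A : L -> cstarAlgType R)
    (G : gradedCStarAlg R L) (e : identification A G)
    (phi : forall i j : L, (i <= j)%O -> A j -> multiplier (A i)) : Prop :=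
  forall (i j : L) (hij : (i <= j)%O) (x : A i) (y : A j),
    e i (lmult (phi i j hij y) x) = e j y ** e i x.

Definition star_iso (K : numClosedFieldType) (A B : starAlgType K)
    (f : A -> B) : Prop := star_hom f /\ bijective f.

(* Main.v *)
Require Import Defs.
From HB Require Import structures.
From mathcomp Require Import all_boot all_order all_algebra.
From mathcomp Require Import complex ring lra.
From mathcomp Require Import all_classical all_reals all_analysis.
Import Order.TTheory GRing.Theory Num.Theory.
Import numFieldNormedType.Exports.

(** Existence. Send x in A_i to the family with coordinate phi_(m,i)(x) in M(A_m)
when m <= i, and 0 for the other m. By condition (b) the finite sums of such
families form a star algebra of families. They are bounded, since star
homomorphisms between C*-algebras are contractive (hom_contractive), so their
uniform closure in the product of the M(A_m) is a C*-algebra G. By condition (a)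
the coordinate of x at i is x itself; hence A_i embeds isometrically, and in a
finite sum the component at a maximal index can be read off the coordinate
there, which gives the independence of the components.

Uniqueness. In any graded algebra G' with these structure morphisms the products
of homogeneous elements are the same as in G (emb_mul), so the formal sums of
homogeneous elements yield isomorphic dense star subalgebras, and it remains to
compare the two norms (emb_isometric). A formal sum lives over a finite
subsemilattice F, and the sums over F form a closed subalgebra of G
(span_on_closed) which maps injectively to G'. An injective star homomorphism of
C*-algebras is isometric (injective_hom_ge); the isometry between the dense
subalgebras then extends to the closures (dense_star_iso).

The two facts about homomorphisms are obtained without spectral theory. Square
roots of 1 - h, for h self-adjoint in the unit ball, come from the iteration
w -> (h + w^2) / 2 (sqrt_iter_lim), and norms are bounded by writing a
self-adjoint s as the real part of a unitary s + i t with s^2 + t^2 = 1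
(nrm_circle). The multiplier algebra serves as unitization throughout. *)

Set Implicit Arguments.
Unset Strict Implicit.
Unset Printing Implicit Defensive.

Local Open Scope classical_set_scope.
Local Open Scope complex_scope.
Local Open Scope ring_scope.

(** * Real-valued norms and convergence of sequences *)

Section RealNorm.
Context {R : realType}.

(** The norm takes values in the complex scalars, where only nonnegative reals
occur; its real part lives in a total order. *)
Definition nrm {V : normedModType R[i]} (x : V) : R := complex.Re `|x|.

Section Normed.
Context {V : normedModType R[i]}.
Implicit Types x y : V.

Lemma nrmE x : `|x| = (nrm x)%:C.
Proof.
rewrite /nrm; have := normr_ge0 x; case: (`|x|) => a b.
by rewrite lecE /= => /andP[/eqP-> _].
Qed.

Lemma nrm_ge0 x : 0 <= nrm x.
Proof. by have := normr_ge0 x; rewrite nrmE lecR. Qed.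

Lemma nrm0 : nrm (0 : V) = 0.
Proof. by rewrite /nrm normr0. Qed.

Lemma nrm0_eq0 x : nrm x = 0 -> x = 0.
Proof. by move=> x0; apply/eqP; rewrite -normr_eq0 nrmE x0. Qed.

Lemma nrm_le0_eq0 x : nrm x <= 0 -> x = 0.
Proof.
by move=> x0; apply: nrm0_eq0; apply/eqP; rewrite eq_le x0 nrm_ge0.
Qed.

Lemma nrmD x y : nrm (x + y) <= nrm x + nrm y.
Proof. by rewrite -lecR rmorphD /= -!nrmE ler_normD. Qed.

Lemma nrmN x : nrm (- x) = nrm x.
Proof. by rewrite /nrm normrN. Qed.

Lemma nrmB x y : nrm (x - y) <= nrm x + nrm y.
Proof. by rewrite -(nrmN y) nrmD. Qed.

Lemma nrm_distC x y : nrm (x - y) = nrm (y - x).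
Proof. by rewrite -opprB nrmN. Qed.

Lemma nrm_dist_trans y x z : nrm (x - z) <= nrm (x - y) + nrm (y - z).
Proof. by rewrite (le_trans _ (nrmD _ _))// addrA subrK. Qed.

Lemma nrm_le_dist x y : nrm x <= nrm y + nrm (x - y).
Proof. by rewrite (le_trans _ (nrmD _ _))// addrC subrK. Qed.

Lemma nrmZ (a : R[i]) x : nrm (a *: x) = complex.Re `|a| * nrm x.
Proof.
by rewrite {1}/nrm normrZ nrmE mulrC; case: (`|a|) => r s /=; ring.
Qed.

Lemma nrmZr (c : R) x : nrm (c%:C *: x) = `|c| * nrm x.
Proof. by rewrite nrmZ normc_def /= expr0n addr0 sqrtr_sqr. Qed.

Lemma ball_nrm x y (c : R) : ball x c%:C y <-> nrm (x - y) < c.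
Proof. by rewrite -ball_normE /ball_ /= nrmE ltcR. Qed.

Lemma gt0_complexE (c : R[i]) : 0 < c -> c = (complex.Re c)%:C.
Proof. by case: c => a b; rewrite ltcE /= => /andP[/eqP-> _]. Qed.

Lemma nbhs_nrm x (P : set V) :
  nbhs x P <-> exists2 c : R, 0 < c & forall y, nrm (x - y) < c -> P y.
Proof.
split=> [/nbhs_ballP[c /= c0 cP]|[c c0 cP]].
  exists (complex.Re c); first by have := c0; rewrite {1}(gt0_complexE c0) ltcR.
  by move=> y xy; apply: cP; rewrite (gt0_complexE c0); apply/ball_nrm.
apply/nbhs_ballP; exists c%:C => /=; first by rewrite ltcR.
by move=> y /ball_nrm; exact: cP.
Qed.

Definition cvs (u : nat -> V) (l : V) : Prop :=
  forall c : R, 0 < c -> exists N, forall n, (N <= n)%N -> nrm (u n - l) < c.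

Lemma cvs_cst l : cvs (fun=> l) l.
Proof. by move=> c c0; exists 0%N => n _; rewrite subrr nrm0. Qed.

Lemma cvs_unique u l l' : cvs u l -> cvs u l' -> l = l'.
Proof.
move=> ul ul'; apply/eqP; rewrite -subr_eq0; apply/eqP/nrm_le0_eq0.
apply/ler_addgt0Pr => c c0; rewrite add0r.
have c2 : 0 < c / 2 by rewrite divr_gt0.
have [N uN] := ul _ c2; have [N' uN'] := ul' _ c2.
have := uN _ (leq_maxl N N'); have := uN' _ (leq_maxr N N').
have := nrm_dist_trans (u (maxn N N')) l l'.
rewrite (nrm_distC l (u _)); lra.
Qed.

Lemma cvs_nrm_le u l (c : R) N : (forall n, (N <= n)%N -> nrm (u n) <= c) ->
  cvs u l -> nrm l <= c.
Proof.
move=> uc ul; apply/ler_addgt0Pr => e e0.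
have [N' /(_ _ (leq_maxr N N'))] := ul _ e0.
have := nrm_le_dist l (u (maxn N N')); rewrite nrm_distC.
have := uc _ (leq_maxl N N'); lra.
Qed.

Lemma closed_nrm (P : set V) : closed P <->
  forall x, (forall c : R, 0 < c -> exists2 y, P y & nrm (x - y) < c) -> P x.
Proof.
split=> [Pc x xP|xP x Px].
  apply: Pc => B /nbhs_nrm[c c0 cB].
  by have [y Py xy] := xP _ c0; exists y; split => //; exact: cB.
apply: xP => c c0.
have /Px[y [Py xy]] : nbhs x [set y | nrm (x - y) < c] by apply/nbhs_nrm; exists c.
by exists y.
Qed.

Lemma closed_cvs (P : set V) u l :
  closed P -> (forall n, P (u n)) -> cvs u l -> P l.
Proof.
move=> /closed_nrm Pc Pu ul; apply: Pc => c c0.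
have [N /(_ N (leqnn N))] := ul _ c0.
by exists (u N) => //; rewrite nrm_distC.
Qed.

Lemma cvsD u v l m : cvs u l -> cvs v m -> cvs (fun n => u n + v n) (l + m).
Proof.
move=> ul vm c c0; have c2 : 0 < c / 2 by rewrite divr_gt0.
have [N uN] := ul _ c2; have [N' vN'] := vm _ c2.
exists (maxn N N') => n; rewrite geq_max => /andP[/uN un /vN' vn].
rewrite opprD addrACA; apply: le_lt_trans (nrmD _ _) _; lra.
Qed.

Lemma cvsS u l : cvs u l -> cvs (fun n => u n.+1) l.
Proof.
move=> ul c c0; have [N uN] := ul _ c0.
by exists N => n Nn; apply: uN; exact: leqW.
Qed.

End Normed.

Lemma cvs_lip {V W : normedModType R[i]} (f : V -> W) (K : R) u l :
  (forall x, nrm (f x - f l) <= K * nrm (x - l)) -> cvs u l ->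
  cvs (f \o u) (f l).
Proof.
move=> fK ul c c0.
have K1 : 0 < `|K| + 1 by rewrite ltr_wpDl.
have [N uN] := ul _ (divr_gt0 c0 K1); exists N => n /uN un /=.
apply: le_lt_trans (fK _) _.
rewrite ltr_pdivlMr// mulrC in un; apply: le_lt_trans un.
by rewrite ler_wpM2r ?nrm_ge0// (le_trans (ler_norm K))// lerDl.
Qed.

Lemma cvsZ {V : normedModType R[i]} (a : R[i]) (u : nat -> V) l :
  cvs u l -> cvs (fun n => a *: u n) (a *: l).
Proof.
by apply: cvs_lip => x /=; rewrite -scalerBr nrmZ.
Qed.

Lemma cauchys_cvs {V : completeNormedModType R[i]} (u : nat -> V) :
  (forall c : R, 0 < c -> exists N, forall m n,
     (N <= m)%N -> (N <= n)%N -> nrm (u m - u n) < c) ->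
  exists l, cvs u l.
Proof.
move=> uc.
have /cauchy_cvgP /cvg_ex[l ul] : cauchy (u @ \oo).
  apply/cauchy_exP => e e0.
  have e1 : 0 < complex.Re e.
    by have := e0; rewrite {1}(gt0_complexE e0) ltcR.
  have [N uN] := uc _ e1; exists (u N); exists N => // n /= Nn.
  by rewrite (gt0_complexE e0); apply/ball_nrm; exact: uN.
exists l => c c0.
have [N _ uN] : (u @ \oo) [set y | nrm (l - y) < c].
  by apply: ul; apply/nbhs_nrm; exists c.
by exists N => n Nn; rewrite nrm_distC; exact: uN.
Qed.

End RealNorm.

(** The minimal data for a C*-algebra. The reverse of the inequality for
scalars comes from inverting the scalar, the reverse of the C*-inequality from
the isometry of the involution, and completeness for Cauchy filters from
completeness for Cauchy sequences. *)
HB.factory Record StarAlg_isCStarAlg (R : realType) A & StarAlg R[i] A := {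
  rnorm : A -> R;
  rnormD : forall x y, rnorm (x + y) <= rnorm x + rnorm y;
  rnormZ : forall (a : R[i]) x, rnorm (a *: x) <= complex.Re `|a| * rnorm x;
  rnorm0 : forall x, rnorm x = 0 -> x = 0;
  rnormM : forall x y, rnorm (x ** y) <= rnorm x * rnorm y;
  rnormC : forall x, rnorm x ^+ 2 <= rnorm (star x ** x);
  rnorm_complete : forall u : nat -> A,
    (forall c : R, 0 < c -> exists N, forall m n,
       (N <= m)%N -> (N <= n)%N -> rnorm (u m - u n) < c) ->
    exists l, forall c : R, 0 < c -> exists N, forall n,
       (N <= n)%N -> rnorm (u n - l) < c
}.

HB.builders Context R A & StarAlg_isCStarAlg R A.

Let cnorm (x : A) : R[i] := (rnorm x)%:C.

Let cnormD x y : cnorm (x + y) <= cnorm x + cnorm y.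
Proof. by rewrite /cnorm -rmorphD lecR rnormD. Qed.

Let cnormZle (a : R[i]) x : cnorm (a *: x) <= `|a| * cnorm x.
Proof.
have -> : `|a| = (complex.Re `|a|)%:C by exact: (@nrmE R R[i]^o a).
by rewrite /cnorm -rmorphM lecR rnormZ.
Qed.

Let cnormZ (a : R[i]) x : cnorm (a *: x) = `|a| * cnorm x.
Proof.
apply/eqP; rewrite eq_le cnormZle andTb.
have [->|a0] := eqVneq a 0.
  rewrite normr0 mul0r scale0r.
  by have := cnormD 0 (- (0 : A)); rewrite subrr oppr0 lerDl.
rewrite -[in leLHS](scale1r x) -(mulVf a0) -scalerA.
by rewrite (le_trans (ler_wpM2l _ (cnormZle _ _)))// mulrA -normrM divff// normr1 mul1r.
Qed.

Let cnorm0 x : cnorm x = 0 -> x = 0.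
Proof. by move=> /complexI /rnorm0. Qed.

HB.instance Definition _ := Lmodule_isNormed.Build R[i] A cnormD cnormZ cnorm0.

Let nrmA (x : A) : nrm x = rnorm x.
Proof. by []. Qed.

Let complete (F : set_system A) : ProperFilter F -> cauchy F -> cvg F.
Proof.
move=> FF /cauchyP Fc.
have e0 n : 0 < (n.+1%:R^-1 : R)%:C by rewrite ltcR invr_gt0.
(* A sequence of points of sets of the filter whose diameters tend to 0. *)
pose u n : A := projT1 (cid (Fc _ (e0 n))).
have uP n : F (ball (u n) (n.+1%:R^-1 : R)%:C) := projT2 (cid (Fc _ (e0 n))).
have uu m n : rnorm (u m - u n) < m.+1%:R^-1 + n.+1%:R^-1.
  have [z [/ball_nrm um /ball_nrm un]] := @filter_ex _ _ FF _ (filterI (uP m) (uP n)).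
  rewrite -nrmA; apply: le_lt_trans (nrm_dist_trans z _ _) _.
  by rewrite (nrm_distC z) ltrD.
have small c : 0 < c -> exists N, forall n, (N <= n)%N -> n.+1%:R^-1 < c :> R.
  move=> c0; exists (Num.truncn c^-1) => n Nn.
  rewrite invf_plt ?posrE//; apply: lt_le_trans (truncnS_gt _) _.
  by rewrite ler_nat ltnS.
have [l ul] : exists l, forall c : R, 0 < c -> exists N, forall n,
       (N <= n)%N -> rnorm (u n - l) < c.
  apply: rnorm_complete => c c0.
  have [N NP] := small _ (divr_gt0 c0 (ltr0n _ 2)); exists N => m n Nm Nn.
  apply: lt_trans (uu _ _) _; rewrite [ltRHS](splitr c) ltrD ?NP//.
apply/cvg_ex; exists l => P /nbhs_nrm[c c0 cP].
have c2 : 0 < c / 2 by rewrite divr_gt0.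
have [N NP] := small _ c2; have [N' uN'] := ul _ c2.
have {}NP := NP _ (leq_maxl N N'); have {}uN' := uN' _ (leq_maxr N N').
apply: filterS (uP (maxn N N')) => z /ball_nrm uz; apply: cP.
apply: le_lt_trans (nrm_dist_trans (u (maxn N N')) _ _) _.
rewrite nrm_distC [ltRHS](splitr c) ltrD// (lt_trans uz)//.
Qed.

HB.instance Definition _ := Uniform_isComplete.Build A complete.

Let cnormM (x y : A) : `|x ** y| <= `|x| * `|y|.
Proof. by rewrite !nrmE -rmorphM lecR rnormM. Qed.

Let norm_le_star (x : A) : nrm x <= nrm (star x).
Proof.
have [->|] := eqVneq (nrm x) 0; first exact: nrm_ge0.
rewrite -[nrm x != 0]negbK; move/negbNE => x0.
have {}x0 : 0 < nrm x by rewrite lt_def x0 nrm_ge0.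
by rewrite -(ler_pM2r x0) -expr2 (le_trans (rnormC x))// rnormM.
Qed.

Let cnormC (x : A) : `|star x ** x| = `|x| ^+ 2.
Proof.
rewrite !nrmE -rmorphXn/=; congr (_ %:C); apply/eqP; rewrite eq_le rnormC andbT.
apply: le_trans (rnormM _ _) _; rewrite expr2; apply: ler_wpM2r; first exact: nrm_ge0 x.
by have := norm_le_star (star x); rewrite starK.
Qed.

HB.instance Definition _ := NormedStarAlg_isCStarAlg.Build R A cnormM cnormC.

HB.end.


(** * Star algebras and their homomorphisms *)

Section StarAlgTheory.
Context {K : numClosedFieldType} {A : starAlgType K}.
Implicit Types x y z : A.

Lemma smul0x x : 0 ** x = 0.
Proof. by apply: (@addIr _ (0 ** x)); rewrite -smulDl !add0r. Qed.

Lemma smulx0 x : x ** 0 = 0.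
Proof. by apply: (@addIr _ (x ** 0)); rewrite -smulDr !add0r. Qed.

Lemma star_0 : star (0 : A) = 0.
Proof. by apply: (@addIr _ (star 0)); rewrite -starD !add0r. Qed.

Lemma smulNl x y : (- x) ** y = - (x ** y).
Proof. by rewrite -scaleN1r -scalersAl scaleN1r. Qed.

Lemma smulNr x y : x ** (- y) = - (x ** y).
Proof. by rewrite -scaleN1r -scalersAr scaleN1r. Qed.

Lemma smulBl x y z : (x - y) ** z = x ** z - y ** z.
Proof. by rewrite smulDl smulNl. Qed.

Lemma smulBr x y z : x ** (y - z) = x ** y - x ** z.
Proof. by rewrite smulDr smulNr. Qed.

Lemma starN x : star (- x) = - star x.
Proof. by rewrite -scaleN1r starZ rmorphN rmorph1 scaleN1r. Qed.

Lemma starB x y : star (x - y) = star x - star y.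
Proof. by rewrite starD starN. Qed.

End StarAlgTheory.

Section StarHom.
Context {K : numClosedFieldType} {A B : starAlgType K} (f : A -> B).
Hypothesis fH : star_hom f.

Lemma star_homD x y : f (x + y) = f x + f y.
Proof. by case: fH => fL _ _; rewrite -[x in LHS]scale1r fL scale1r. Qed.

Lemma star_hom0 : f 0 = 0.
Proof. by apply: (@addIr _ (f 0)); rewrite -star_homD !add0r. Qed.

Lemma star_homZ a x : f (a *: x) = a *: f x.
Proof. by case: fH => fL _ _; rewrite -[a *: x]addr0 fL star_hom0 addr0. Qed.

Lemma star_homN x : f (- x) = - f x.
Proof. by rewrite -scaleN1r star_homZ scaleN1r. Qed.

Lemma star_homM x y : f (x ** y) = f x ** f y.
Proof. by case: fH. Qed.

Lemma star_homS x : f (star x) = star (f x).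
Proof. by case: fH. Qed.

End StarHom.

Section CStarNorm.
Context {R : realType} {A : cstarAlgType R}.
Implicit Types x y z : A.

Lemma nrmM x y : nrm (x ** y) <= nrm x * nrm y.
Proof. by rewrite -lecR rmorphM /= -!nrmE normsM. Qed.

Lemma nrm_star x : nrm (star x) = nrm x.
Proof. by rewrite /nrm norm_star. Qed.

Lemma nrm_cstar x : nrm (star x ** x) = nrm x ^+ 2.
Proof. by apply: complexI; rewrite rmorphXn /= -!nrmE normCstar. Qed.

Lemma nrm_sqr x : star x = x -> nrm (x ** x) = nrm x ^+ 2.
Proof. by move=> sx; rewrite -nrm_cstar sx. Qed.

Lemma starM_eq0 x : star x ** x = 0 -> x = 0.
Proof.
move=> /(congr1 nrm); rewrite nrm_cstar nrm0 => /eqP.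
by rewrite sqrf_eq0 => /eqP/nrm0_eq0.
Qed.

Lemma cvsM (u v : nat -> A) l m :
  cvs u l -> cvs v m -> cvs (fun n => u n ** v n) (l ** m).
Proof.
move=> ul vm c c0.
pose K := nrm l + nrm m + 1.
have K0 : 0 < K by rewrite ltr_wpDl// addr_ge0// nrm_ge0.
pose e := Num.min 1 (c / (K *+ 2)).
have e0 : 0 < e by rewrite lt_min ltr01 divr_gt0// pmulrn_lgt0.
have [N uN] := ul _ e0; have [N' vN] := vm _ e0.
exists (maxn N N') => n; rewrite geq_max => /andP[/uN un /vN vn].
have -> : u n ** v n - l ** m = (u n - l) ** v n + l ** (v n - m).
  by rewrite smulBl smulBr addrA subrK.
apply: le_lt_trans (nrmD _ _) _.
apply: le_lt_trans (lerD (nrmM _ _) (nrmM _ _)) _.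
have vK : nrm (v n) <= nrm m + 1.
  rewrite (le_trans (nrm_le_dist _ m))// lerD2l (le_trans (ltW vn))//.
  by rewrite /e ge_min lexx.
have le1 : nrm (u n - l) * nrm (v n) <= e * (nrm m + 1).
  by rewrite ler_pM ?nrm_ge0// ltW.
have le2 : nrm l * nrm (v n - m) <= nrm l * e.
  by rewrite ler_wpM2l ?nrm_ge0// ltW.
have eK : e * (K *+ 2) <= c.
  by rewrite -ler_pdivlMr ?pmulrn_lgt0// /e ge_min lexx orbT.
have := mulr_gt0 e0 K0; rewrite /K in eK *; lra.
Qed.

Lemma cvs_star (u : nat -> A) l :
  cvs u l -> cvs (fun n => star (u n)) (star l).
Proof.
by apply: (cvs_lip (K := 1)) => x /=; rewrite -starB nrm_star mul1r.
Qed.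

End CStarNorm.

(** * The multiplier algebra as a unital C*-algebra *)

Section MultiplierNorm.
Context {R : realType} {A : cstarAlgType R}.
Implicit Types (m n : multiplier A) (x y z : A).

Lemma smul_inj_l x y : (forall z, z ** x = z ** y) -> x = y.
Proof.
move=> xy; apply/eqP; rewrite -subr_eq0; apply/eqP/starM_eq0.
by rewrite smulBr xy subrr.
Qed.

Lemma smul_inj_r x y : (forall z, x ** z = y ** z) -> x = y.
Proof.
move=> xy; apply: (can_inj (@starK _ A)); apply: smul_inj_l => z.
by apply: (can_inj (@starK _ A)); rewrite !starM !starK.
Qed.

(** The identity (x m) y = x (m y) recovers the right half of m from its left
half. *)
Lemma multiplier_lext m n : lmult m =1 lmult n -> m = n.
Proof.
move=> mn; apply: multiplier_ext => // x.
by apply: smul_inj_r => y; rewrite !rmult_lmult mn.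
Qed.

Lemma lmult0 m : lmult m 0 = 0.
Proof. by have := lmultZ m 0 0; rewrite !scale0r. Qed.

Definition opnorm m : R := sup [set nrm (lmult m x) | x in [set x : A | nrm x <= 1]].

Let opnorm_has_sup m :
  has_sup [set nrm (lmult m x) | x in [set x : A | nrm x <= 1]].
Proof.
split; first by exists (nrm (lmult m 0)), 0 => //=; rewrite nrm0 ler01.
have [M M0 mM] := bounded_operator_ge0 (lmult_bounded m).
exists (complex.Re M) => _ [x /= x1 <-].
have ME : M = (complex.Re M)%:C.
  by move: M0; case: (M) => a b; rewrite lecE/= => /andP[/eqP-> _].
rewrite -lecR -nrmE -ME (le_trans (mM x))// -[leRHS]mulr1 ler_wpM2l//.
by rewrite nrmE lecR.
Qed.

Lemma opnorm_le m x : nrm (lmult m x) <= opnorm m * nrm x.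
Proof.
have [x0|/eqP x0] := pselect (nrm x = 0).
  by rewrite (nrm0_eq0 x0) lmult0 nrm0 mulr0.
have nx : 0 < nrm x by rewrite lt_def x0 nrm_ge0.
rewrite -ler_pdivrMr//.
have -> : nrm (lmult m x) / nrm x = nrm (lmult m ((nrm x)^-1%:C *: x)).
  by rewrite lmultZ nrmZr gtr0_norm ?invr_gt0// mulrC.
apply: (ub_le_sup (proj2 (opnorm_has_sup m))); exists ((nrm x)^-1%:C *: x) => //=.
by rewrite nrmZr gtr0_norm ?invr_gt0// mulVf.
Qed.

Lemma opnorm_min m (c : R) : 0 <= c ->
  (forall x, nrm (lmult m x) <= c * nrm x) -> opnorm m <= c.
Proof.
move=> c0 mc; apply: (ge_sup (proj1 (opnorm_has_sup m))) => _ [x /= x1 <-].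
by rewrite (le_trans (mc x))// -[leRHS]mulr1 ler_wpM2l.
Qed.

Lemma opnorm_ge0 m : 0 <= opnorm m.
Proof.
apply: le_trans (nrm_ge0 (lmult m 0)) _.
by apply: (ub_le_sup (proj2 (opnorm_has_sup m))); exists 0 => //=; rewrite nrm0 ler01.
Qed.

(** The C*-identity turns the bound on the left half of a double centraliser
into the same bound on its right half. *)
Lemma opnorm_ler m x : nrm (rmult m x) <= opnorm m * nrm x.
Proof.
have [->|/eqP x0] := pselect (nrm (rmult m x) = 0).
  by rewrite mulr_ge0 ?nrm_ge0 ?opnorm_ge0.
have nx : 0 < nrm (rmult m x) by rewrite lt_def x0 nrm_ge0.
rewrite -(ler_pM2r nx) -expr2 -nrm_star -nrm_cstar starK rmult_lmult.
rewrite (le_trans (nrmM _ _))// mulrC mulrAC ler_wpM2r ?nrm_ge0//.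
by rewrite (le_trans (opnorm_le _ _))// nrm_star.
Qed.

Let opnormD m n : opnorm (m + n) <= opnorm m + opnorm n.
Proof.
apply: opnorm_min => [|x]; first by rewrite addr_ge0 ?opnorm_ge0.
by rewrite (le_trans (nrmD _ _))// mulrDl lerD ?opnorm_le.
Qed.

Let opnormZ (a : R[i]) m : opnorm (a *: m) <= complex.Re `|a| * opnorm m.
Proof.
have a0 : 0 <= complex.Re `|a| by have := normr_ge0 a; rewrite lecE => /andP[].
apply: opnorm_min => [|x]; first by rewrite mulr_ge0 ?opnorm_ge0.
by rewrite nrmZ -mulrA ler_wpM2l ?opnorm_le.
Qed.

Let opnorm0 m : opnorm m = 0 -> m = 0.
Proof.
move=> m0; apply: multiplier_lext => x; apply: nrm_le0_eq0.
by rewrite (le_trans (opnorm_le _ _))// m0 mul0r.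
Qed.

Let opnormM m n : opnorm (m ** n) <= opnorm m * opnorm n.
Proof.
apply: opnorm_min => [|x]; first by rewrite mulr_ge0 ?opnorm_ge0.
apply: le_trans (opnorm_le m (lmult n x)) _.
by rewrite -mulrA ler_wpM2l ?opnorm_ge0 ?opnorm_le.
Qed.

(** |m x|^2 = |x* (m* m x)|. *)
Let opnormC m : opnorm m ^+ 2 <= opnorm (star m ** m).
Proof.
rewrite -[leRHS]sqr_sqrtr ?opnorm_ge0// ler_pXn2r ?nnegrE ?opnorm_ge0 ?sqrtr_ge0//.
apply: opnorm_min => [|x]; first exact: sqrtr_ge0.
rewrite -(@ler_pXn2r _ 2) ?nnegrE ?nrm_ge0 ?mulr_ge0 ?sqrtr_ge0 ?nrm_ge0//.
rewrite exprMn sqr_sqrtr ?opnorm_ge0// -nrm_cstar -rmult_lmult.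
have -> : rmult m (star (lmult m x)) = star (lmult (star m ** m) x).
  by rewrite -[RHS]/(star (star (rmult m (star (lmult m x))))) starK.
rewrite (le_trans (nrmM _ _))// expr2 mulrA ler_wpM2r ?nrm_ge0// nrm_star.
exact: opnorm_le.
Qed.

(** Both halves of the sequence converge pointwise, uniformly on bounded sets. *)
Let opnorm_complete (u : nat -> multiplier A) :
  (forall c : R, 0 < c -> exists N, forall i j,
     (N <= i)%N -> (N <= j)%N -> opnorm (u i - u j) < c) ->
  exists l, forall c : R, 0 < c -> exists N, forall i,
     (N <= i)%N -> opnorm (u i - l) < c.
Proof.
move=> uc.
have pt (f : multiplier A -> A -> A) (x : A) :
    (forall m n y, f (m - n) y = f m y - f n y) ->
    (forall m y, nrm (f m y) <= opnorm m * nrm y) ->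
    exists l, cvs (fun k => f (u k) x) l.
  move=> fB fle; apply: cauchys_cvs => c c0.
  have x1 : 0 < nrm x + 1 by rewrite ltr_wpDl ?nrm_ge0.
  have [N uN] := uc _ (divr_gt0 c0 x1); exists N => i j Ni Nj.
  have := uN _ _ Ni Nj; rewrite ltr_pdivlMr// => le1.
  rewrite -fB; apply: le_lt_trans (fle _ _) (le_lt_trans _ le1).
  by rewrite ler_wpM2l ?opnorm_ge0// lerDl.
have lB m n y : lmult (m - n) y = lmult m y - lmult n y.
  by rewrite -[LHS]/(lmult m y + (-1) *: lmult n y) scaleN1r.
have rB m n y : rmult (m - n) y = rmult m y - rmult n y.
  by rewrite -[LHS]/(rmult m y + (-1) *: rmult n y) scaleN1r.
pose l x : A := projT1 (cid (pt (@lmult R A) x lB opnorm_le)).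
have ul x : cvs (fun k => lmult (u k) x) (l x) := projT2 (cid (pt (@lmult R A) x lB opnorm_le)).
pose r x : A := projT1 (cid (pt (@rmult R A) x rB opnorm_ler)).
have ur x : cvs (fun k => rmult (u k) x) (r x) := projT2 (cid (pt (@rmult R A) x rB opnorm_ler)).
have [N1 uN1] := uc _ ltr01.
have ubd (n : nat) : (N1 <= n)%N -> opnorm (u n) <= opnorm (u N1) + 1.
  move=> Nn; have -> : u n = u N1 + (u n - u N1) by rewrite addrC subrK.
  by rewrite (le_trans (opnormD _ _))// lerD2l ltW// uN1.
have bdd (f : multiplier A -> A -> A) (g : A -> A) :
    (forall m y, nrm (f m y) <= opnorm m * nrm y) ->
    (forall x, cvs (fun k => f (u k) x) (g x)) -> bounded_operator g.
  move=> fle fg; exists (opnorm (u N1) + 1)%:C => x.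
  rewrite !nrmE -rmorphM lecR.
  apply: (cvs_nrm_le (N := N1)) (fg x) => n Nn.
  by rewrite (le_trans (fle _ _))// ler_wpM2r ?nrm_ge0 ?ubd.
have lL : linear l.
  move=> a x y; apply: cvs_unique (ul _) _.
  rewrite (_ : (fun k => _) = (fun k => a *: lmult (u k) x + lmult (u k) y)).
    by apply: cvsD => //; exact: cvsZ.
  by apply/funext => k; rewrite lmult_linear.
have rL : linear r.
  move=> a x y; apply: cvs_unique (ur _) _.
  rewrite (_ : (fun k => _) = (fun k => a *: rmult (u k) x + rmult (u k) y)).
    by apply: cvsD => //; exact: cvsZ.
  by apply/funext => k; rewrite rmult_linear.
have lM x y : l (x ** y) = l x ** y.
  apply: cvs_unique (ul _) _.
  rewrite (_ : (fun k => _) = (fun k => lmult (u k) x ** y)).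
    by apply: cvsM => //; exact: cvs_cst.
  by apply/funext => k; rewrite lmultM.
have rM x y : r (x ** y) = x ** r y.
  apply: cvs_unique (ur _) _.
  rewrite (_ : (fun k => _) = (fun k => x ** rmult (u k) y)).
    by apply: cvsM => //; exact: cvs_cst.
  by apply/funext => k; rewrite rmultM.
have rl x y : r x ** y = x ** l y.
  apply: cvs_unique (_ : cvs (fun k => rmult (u k) x ** y) _) _.
    by apply: cvsM => //; exact: cvs_cst.
  rewrite (_ : (fun k => _) = (fun k => x ** lmult (u k) y)).
    by apply: cvsM => //; exact: cvs_cst.
  by apply/funext => k; rewrite rmult_lmult.
exists (Multiplier lL rL (bdd _ _ opnorm_le ul) (bdd _ _ opnorm_ler ur) lM rM rl).
move=> c c0; have c2 : 0 < c / 2 by rewrite divr_gt0.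
have [N uN] := uc _ c2; exists N => n Nn.
apply: (@le_lt_trans _ _ (c / 2)); last by lra.
apply: opnorm_min => [|x]; first exact: ltW.
rewrite lB /= nrm_distC.
apply: (cvs_nrm_le (N := N) (u := fun k => lmult (u k) x - lmult (u n) x)).
  move=> k Nk; rewrite -lB (le_trans (opnorm_le _ _))// ler_wpM2r ?nrm_ge0//.
  by rewrite ltW// uN.
by apply: cvsD => //; exact: cvs_cst.
Qed.

HB.instance Definition _ := StarAlg_isCStarAlg.Build R (multiplier A)
  opnormD opnormZ opnorm0 opnormM opnormC opnorm_complete.

Lemma nrm_lmult m x : nrm (lmult m x) <= nrm m * nrm x.
Proof. exact: opnorm_le. Qed.

Lemma nrm_multiplier m (c : R) : 0 <= c ->
  (forall x, nrm (lmult m x) <= c * nrm x) -> nrm m <= c.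
Proof. exact: opnorm_min. Qed.

Let bounded_id : bounded_operator (@id A).
Proof. by exists 1 => x; rewrite mul1r. Qed.

Definition mult_one : multiplier A :=
  @Multiplier R A id id (fun _ _ _ => erefl) (fun _ _ _ => erefl)
    bounded_id bounded_id
    (fun _ _ => erefl) (fun _ _ => erefl) (fun _ _ => erefl).

Lemma mult_1m m : mult_one ** m = m.
Proof. exact: multiplier_ext. Qed.

Lemma mult_m1 m : m ** mult_one = m.
Proof. exact: multiplier_ext. Qed.

Lemma star_hom_incl : star_hom (@mult_incl R A).
Proof.
split=> [a x y|x y|x]; apply: multiplier_ext => z /=.
- by rewrite smulDl scalersAl.
- by rewrite smulDr scalersAr.
- by rewrite smulA.
- by rewrite smulA.
- by rewrite starM starK.
- by rewrite starM starK.
Qed.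

Lemma nrm_incl x : nrm (mult_incl x) = nrm x.
Proof.
apply/eqP; rewrite eq_le; apply/andP; split.
  by apply: nrm_multiplier => [|y]; rewrite ?nrm_ge0//= nrmM.
have [->|/eqP x0] := pselect (nrm x = 0); first exact: nrm_ge0.
have nx : 0 < nrm x by rewrite lt_def x0 nrm_ge0.
rewrite -(ler_pM2r nx) -expr2 -(nrm_star x) -nrm_cstar starK.
exact: (nrm_lmult (mult_incl x)).
Qed.

Lemma incl_inj : injective (@mult_incl R A).
Proof.
move=> x y xy; apply/eqP; rewrite -subr_eq0; apply/eqP/nrm0_eq0.
by rewrite -nrm_incl (star_homD star_hom_incl) (star_homN star_hom_incl) xy subrr nrm0.
Qed.

End MultiplierNorm.

(** * Square roots by iteration *)

Section RealScalars.
Context {R : realType} {A : starAlgType R[i]}.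
Implicit Types (x y z : A) (c d : R).

Lemma scaler_smul c d x y :
  (c%:C *: x) ** (d%:C *: y) = (c * d)%:C *: (x ** y).
Proof. by rewrite -scalersAl -scalersAr scalerA rmorphM. Qed.

Lemma star_scaler c x : star (c%:C *: x) = c%:C *: star x.
Proof.
rewrite starZ; congr (_ *: _).
by apply: (conj_Creal (x := c%:C)); rewrite complex_real.
Qed.

Definition commutes x y : Prop := x ** y = y ** x.

Lemma commutes_sym x y : commutes x y -> commutes y x.
Proof. by []. Qed.

Lemma commutesM x y z : commutes x z -> commutes y z -> commutes (x ** y) z.
Proof. by move=> xz yz; rewrite /commutes -smulA yz smulA xz smulA. Qed.

Lemma commutesD x y z : commutes x z -> commutes y z -> commutes (x + y) z.
Proof. by move=> xz yz; rewrite /commutes smulDl smulDr xz yz. Qed.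

Lemma commutesB x y z : commutes x z -> commutes y z -> commutes (x - y) z.
Proof. by move=> xz yz; rewrite /commutes smulBl smulBr xz yz. Qed.

Lemma commutesZ (a : R[i]) x z : commutes x z -> commutes (a *: x) z.
Proof. by move=> xz; rewrite /commutes -scalersAl -scalersAr xz. Qed.

Lemma star_commutesM x y : star x = x -> star y = y -> commutes x y -> star (x ** y) = x ** y.
Proof. by move=> sx sy xy; rewrite starM sx sy. Qed.

Lemma commutes_sqr x y : commutes x y -> (x ** y) ** (x ** y) = (x ** x) ** (y ** y).
Proof. by move=> xy; rewrite !smulA -(smulA x y x) -xy !smulA. Qed.

End RealScalars.

Section SquareRoot.
Context {R : realType}.
Let half : R[i] := (2^-1 : R)%:C.

(** The iteration w -> (h + w^2) / 2, whose fixed points satisfy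
(1 - w)^2 = 1 - h. *)
Fixpoint sqrt_iter {A : starAlgType R[i]} (h : A) n : A :=
  if n is k.+1 then half *: (h + sqrt_iter h k ** sqrt_iter h k) else 0.

(** The scalar iteration for h = 1; it increases to 1 and bounds the increments
of every iteration with h in the unit ball. *)
Fixpoint sqrt_iter1 n : R :=
  if n is k.+1 then 2^-1 * (1 + sqrt_iter1 k ^+ 2) else 0.

Lemma sqrt_iter1_bound n : 0 <= sqrt_iter1 n <= 1.
Proof.
by elim: n => [|n /andP[w0 w1]] /=; apply/andP; split => //; nra.
Qed.

(** With x = 1 - w the recursion reads x -> x - x^2 / 2. *)
Lemma sqrt_iter1_rate n : 1 - sqrt_iter1 n <= 2 / (n.+2)%:R.
Proof.
elim: n => [|n IH]; first by rewrite subr0 divff.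
have -> : 1 - sqrt_iter1 n.+1 = (1 - sqrt_iter1 n) - (1 - sqrt_iter1 n) ^+ 2 / 2 by rewrite /=; field.
have /andP[w0 w1] := sqrt_iter1_bound n.
set d := 1 - sqrt_iter1 n in IH *; have d0 : 0 <= d by rewrite subr_ge0.
set k : R := n.+2%:R in IH *.
have k2 : 2 <= k by rewrite ler_nat.
have -> : n.+3%:R = k + 1 :> R by rewrite -natr1.
have k0 : 0 < k by rewrite ltr0n.
have q1 : 2 / k <= 1 by rewrite ler_pdivrMr ?mul1r.
clearbody k.
apply: (@le_trans _ _ (2 / k - (2 / k) ^+ 2 / 2)); first by rewrite /=; nra.
have k1 : 0 < k + 1 by lra.
rewrite -subr_ge0.
have -> : 2 / (k + 1) - (2 / k - (2 / k) ^+ 2 / 2) = 2 / ((k + 1) * k ^+ 2).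
  by field; apply/andP; split; lra.
by rewrite divr_ge0// mulr_ge0 ?exprn_ge0 1?ltW.
Qed.

Section Cstar.
Context {A : cstarAlgType R}.
Implicit Types (h w x y z : A).

Lemma sub_cstarB (P : set A) x y : sub_cstar P -> P x -> P y -> P (x - y).
Proof.
move=> PP Px Py; rewrite -scaleN1r.
by apply: (sub_cstarD PP) => //; exact: (sub_cstarZ PP).
Qed.

Lemma sub_cstar_commutes z : star z = z -> sub_cstar [set x | commutes x z].
Proof.
move=> sz; split => [||x y|a x|x y|x].
- apply/closed_nrm => x xz; apply/eqP; rewrite -subr_eq0; apply/eqP.
  apply/nrm_le0_eq0/ler_addgt0Pr => c c0; rewrite add0r.
  have k0 : 0 < nrm z *+ 2 + 1 by rewrite ltr_wpDl// mulrn_wge0 ?nrm_ge0.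
  have [y /= yz xy] := xz _ (divr_gt0 c0 k0).
  have -> : x ** z - z ** x = (x - y) ** z - z ** (x - y).
    by rewrite smulBl smulBr yz; rewrite opprB addrA subrK.
  have m1 := nrmM (x - y) z; have m2 := nrmM z (x - y).
  rewrite ltr_pdivlMr// in xy.
  have := nrmB ((x - y) ** z) (z ** (x - y)).
  have := nrm_ge0 (x - y); have := nrm_ge0 z; nra.
- by rewrite /= /commutes smul0x smulx0.
- exact: commutesD.
- exact: commutesZ.
- exact: commutesM.
- by move=> /(congr1 star); rewrite /= !starM sz.
Qed.

Lemma sqrt_iter_in (P : set A) h n : sub_cstar P -> P h -> P (sqrt_iter h n).
Proof.
move=> PP Ph; elim: n => [|n IH] /=; first exact: (sub_cstar0 PP).
apply/(sub_cstarZ PP)/(sub_cstarD PP) => //.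
exact: (sub_cstarM PP).
Qed.

Lemma sqrt_iter_star h n : star h = h -> star (sqrt_iter h n) = sqrt_iter h n.
Proof.
move=> sh; elim: n => [|n IH] /=; first exact: star_0.
by rewrite star_scaler starD starM sh IH.
Qed.

Let nrm_half x : nrm (half *: x) = 2^-1 * nrm x.
Proof. by rewrite nrmZr gtr0_norm ?invr_gt0. Qed.

Lemma sqrt_iter_nrm h n : nrm h <= 1 -> nrm (sqrt_iter h n) <= sqrt_iter1 n.
Proof.
move=> h1; elim: n => [|n IH] /=; first by rewrite nrm0.
rewrite nrm_half ler_wpM2l ?invr_ge0//.
rewrite (le_trans (nrmD _ _))// lerD// (le_trans (nrmM _ _))//.
by rewrite expr2 ler_pM ?nrm_ge0.
Qed.

Lemma sqrt_iter_dist h n k : nrm h <= 1 ->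
  nrm (sqrt_iter h (n + k) - sqrt_iter h n) <= sqrt_iter1 (n + k) - sqrt_iter1 n.
Proof.
move=> h1; elim: n => [|n IH]; first by rewrite /= !subr0 sqrt_iter_nrm.
rewrite addSn /= -scalerBr nrm_half opprD addrACA subrr add0r.
set x := sqrt_iter h (n + k) in IH *; set y := sqrt_iter h n in IH *.
have -> : x ** x - y ** y = x ** (x - y) + (x - y) ** y.
  by rewrite smulBr smulBl addrA subrK.
have xl : nrm x <= sqrt_iter1 (n + k) by exact: sqrt_iter_nrm.
have yl : nrm y <= sqrt_iter1 n by exact: sqrt_iter_nrm.
have m1 := nrmM x (x - y); have m2 := nrmM (x - y) y.
have := nrmD (x ** (x - y)) ((x - y) ** y).
have := nrm_ge0 x; have := nrm_ge0 y; have := nrm_ge0 (x - y); nra.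
Qed.

(** The limit w is 1 - sqrt (1 - h). No unit is involved, so that w belongs to
every closed star subalgebra containing h; applied to commutants, this shows
that w commutes with whatever self-adjoint element commutes with h. *)
Lemma sqrt_iter_lim h : star h = h -> nrm h <= 1 -> exists w,
  [/\ cvs (sqrt_iter h) w, w + w = h + w ** w, star w = w, nrm w <= 1 &
      forall P, sub_cstar P -> P h -> P w].
Proof.
move=> sh h1.
have [w hw] : exists w, cvs (sqrt_iter h) w.
  apply: cauchys_cvs => c c0.
  have [N NP] : exists N : nat, 2 / N.+2%:R < c / 2.
    exists (Num.truncn (4 / c)); rewrite ltr_pdivrMr//.
    have := truncnS_gt (4 / c); rewrite ltr_pdivrMr// => lt4.
    rewrite -(natr1 (Num.truncn (4 / c)).+1); move: (Num.truncn (4 / c)).+1%:R lt4 => k lt4.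
    have -> : c / 2 * (k + 1) = (k * c + c) / 2 by ring.
    lra.
  have dN n : (N <= n)%N -> nrm (sqrt_iter h n - sqrt_iter h N) < c / 2.
    move=> Nn; rewrite -(subnKC Nn); apply: le_lt_trans (sqrt_iter_dist _ _ h1) _.
    apply: le_lt_trans NP; apply: le_trans (sqrt_iter1_rate N).
    by rewrite lerD2r; have /andP[] := sqrt_iter1_bound (N + (n - N)).
  exists N => m n /dN mN /dN nN.
  apply: le_lt_trans (nrm_dist_trans (sqrt_iter h N) _ _) _.
  rewrite (nrm_distC (sqrt_iter h N)); lra.
exists w; split => //.
- have wE : w = half *: (h + w ** w).
    apply: cvs_unique (cvsS hw) _; apply: cvsZ; apply: cvsD; first exact: cvs_cst.
    exact: cvsM.
  have hh : half + half = 1 by rewrite /half -rmorphD -[2^-1]mul1r -splitr.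
  by rewrite {1 2}wE -scalerDl hh scale1r.
- apply: cvs_unique (hw); rewrite (_ : sqrt_iter h = star \o sqrt_iter h); first exact: cvs_star.
  by apply/funext => n /=; rewrite sqrt_iter_star.
- apply: (cvs_nrm_le (N := 0%N)) hw => n _.
  by rewrite (le_trans (sqrt_iter_nrm _ _))//; have /andP[] := sqrt_iter1_bound n.
- move=> P PP Ph; apply: closed_cvs (sub_cstar_closed PP) _ hw => n.
  exact: sqrt_iter_in.
Qed.

End Cstar.
End SquareRoot.

(** * Squares in unital C*-algebras *)

Section Unital.
Context {R : realType} {U : cstarAlgType R} (e : U).
Hypothesis e1x : forall x, e ** x = x.
Hypothesis ex1 : forall x, x ** e = x.
Implicit Types s t u v w x y z : U.
#[local] Set Default Proof Using "All".

Lemma star_one : star e = e.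
Proof. by rewrite -[LHS]ex1 -[RHS]starK -[in RHS](ex1 (star e)) starM starK. Qed.

Lemma nrm_one : nrm e <= 1.
Proof.
have [->//|/eqP e0] := pselect (nrm e = 0).
have ne : 0 < nrm e by rewrite lt_def e0 nrm_ge0.
by rewrite -(ler_pM2r ne) mul1r -expr2 -nrm_cstar star_one ex1.
Qed.

Lemma commutes_one x : commutes e x.
Proof. by rewrite /commutes e1x ex1. Qed.

(** The element s + i t is unitary, hence of norm at most 1, and s is its real
part. *)
Lemma nrm_circle s t : star s = s -> star t = t -> commutes s t ->
  s ** s + t ** t = e -> nrm s <= 1.
Proof.
move=> ss st cst circ.
pose i : R[i] := 'i%C.
have ii : i * i = -1 by rewrite -expr2 sqr_i.
pose u := s + i *: t.
have su : star u = s - i *: t.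
  rewrite starD starZ ss st -scaleNr; congr (_ + _ *: _).
  by apply/eqP; rewrite eq_complex /= oppr0 !eqxx.
have uu : star u ** u = e.
  rewrite su /u smulBl !smulDr -!scalersAl -!scalersAr scalerA ii scaleN1r.
  by rewrite cst opprD opprK addrA addrK.
have u1 : nrm u <= 1.
  rewrite -(@ler_pXn2r _ 2) ?nnegrE ?nrm_ge0// expr1n -nrm_cstar uu.
  exact: nrm_one.
have -> : s = (2^-1 : R)%:C *: (u + star u).
  rewrite su /u addrACA subrr addr0 -{2 3}[s]scale1r -scalerDl scalerA.
  by rewrite fmorphV rmorph_nat -[1 + 1]/(2%:R) mulVf ?pnatr_eq0// scale1r.
rewrite nrmZr gtr0_norm ?invr_gt0//.
by have := nrmD u (star u); rewrite nrm_star; lra.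
Qed.

Lemma one_sub_sqr h w : w + w = h + w ** w -> (e - w) ** (e - w) = e - h.
Proof.
move=> ww; have -> : h = w + w - w ** w by rewrite ww addrK.
by rewrite smulBl !smulBr !e1x ex1 -addrA -opprD addrA.
Qed.

Lemma sqrt_one_sub h : star h = h -> nrm h <= 1 -> exists s,
  [/\ star s = s, s ** s = e - h &
      forall z, star z = z -> commutes h z -> commutes s z].
Proof.
move=> sh h1; have [w [_ ww sw _ wP]] := sqrt_iter_lim sh h1.
exists (e - w); split; first by rewrite starB star_one sw.
  exact: one_sub_sqr.
move=> z sz hz; apply: commutesB (commutes_one _) _.
exact: (wP _ (sub_cstar_commutes sz)).
Qed.

(** With t = sqrt (1 - s^2), both s and t lie on the unit circle. *)
Lemma nrm_one_sub_sqr s : star s = s -> nrm s <= 1 -> nrm (e - s ** s) <= 1.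
Proof.
move=> ss s1.
have [||t [st tt ct]] := @sqrt_one_sub (s ** s).
- by rewrite starM ss.
- by rewrite nrm_sqr// expr_le1 ?nrm_ge0.
have t1 : nrm t <= 1.
  by apply: (@nrm_circle t s) => //; [apply: ct => //; exact: commutesM | rewrite tt subrK].
by rewrite -tt nrm_sqr// expr_le1 ?nrm_ge0.
Qed.

(** After scaling u and v to a and b in the unit ball, 1 - (a^2 + b^2) / 4 is 1/2 plus a quarter of 1 - a^2 and a quarter
of 1 - b^2, hence of norm at most 1. *)
Lemma sum_sqr u v : star u = u -> star v = v -> exists r,
  [/\ star r = r, r ** r = u ** u + v ** v &
      forall z, star z = z -> commutes (u ** u + v ** v) z -> commutes r z].
Proof.
move=> su sv.
pose k : R := 1 + nrm u + nrm v.
have k1 : 1 <= k by rewrite /k -addrA lerDl addr_ge0 ?nrm_ge0.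
have k0 : 0 < k by lra.
pose a := k^-1%:C *: u; pose b := k^-1%:C *: v.
have le1 x : nrm x <= k -> nrm (k^-1%:C *: x) <= 1.
  by move=> xk; rewrite nrmZr gtr0_norm ?invr_gt0// ler_pdivrMl// mulr1.
have a1 : nrm (e - a ** a) <= 1.
  apply: nrm_one_sub_sqr; first by rewrite star_scaler su.
  by apply: le1; rewrite /k; have := nrm_ge0 v; lra.
have b1 : nrm (e - b ** b) <= 1.
  apply: nrm_one_sub_sqr; first by rewrite star_scaler sv.
  by apply: le1; rewrite /k; have := nrm_ge0 u; lra.
pose q : R[i] := (4^-1 : R)%:C.
pose h := e - q *: (a ** a + b ** b).
have hE : h = (2^-1 : R)%:C *: e + (q *: (e - a ** a) + q *: (e - b ** b)).
  rewrite /h scalerDr !scalerBr addrACA -opprD -scalerDl addrA -scalerDl.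
  rewrite /q -!rmorphD (_ : _ + _ = 1) ?scale1r//.
  by field.
have h1 : nrm h <= 1.
  rewrite hE; apply: le_trans (nrmD _ _) _.
  apply: le_trans (lerD (lexx _) (nrmD _ _)) _.
  rewrite !nrmZr !gtr0_norm ?invr_gt0//.
  have := nrm_one; lra.
have sh : star h = h.
  rewrite /h starB star_one star_scaler starD !starM !star_scaler.
  by rewrite su sv.
have [s [ss sE sc]] := sqrt_one_sub sh h1.
have ssE : s ** s = (4^-1 * (k^-1 * k^-1))%:C *: (u ** u + v ** v).
  rewrite sE /h subKr /a /b !scaler_smul -scalerDr scalerA.
  by rewrite /q -rmorphM.
exists ((k * 2)%:C *: s); split; first by rewrite star_scaler ss.
  rewrite scaler_smul ssE scalerA -rmorphM.
  rewrite (_ : _ * _ = 1) ?scale1r//.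
  by field; apply/eqP => k00; move: k0; rewrite k00 ltxx.
move=> z sz uz; apply/commutesZ/sc => //.
apply: commutesB (commutes_one _) _; rewrite /a /b !scaler_smul -scalerDr.
by do 2 apply: commutesZ.
Qed.

(** Put w^2 = 1 - (u^2 + v^2) and z^2 = v^2 + w^2; then u^2 + z^2 = 1. *)
Lemma nrm_sum_sqr1 u v : star u = u -> star v = v -> commutes u v ->
  nrm (u ** u + v ** v) <= 1 -> nrm u <= 1.
Proof.
move=> su sv uv n1.
have sh : star (u ** u + v ** v) = u ** u + v ** v.
  by rewrite starD !starM su sv.
have [w [sw ww wc]] := sqrt_one_sub sh n1.
have [z [sz zz zc]] := sum_sqr sv sw.
have vu : commutes v u by exact: commutes_sym.
apply: (@nrm_circle u z) => //.
  apply: commutes_sym; apply: zc => //; apply: commutesD; first exact: commutesM.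
  by rewrite ww; apply: commutesB; [exact: commutes_one | apply: commutesD; exact: commutesM].
by rewrite zz addrA ww addrC subrK.
Qed.

Lemma nrm_sum_sqr u v : star u = u -> star v = v -> commutes u v ->
  nrm u ^+ 2 <= nrm (u ** u + v ** v).
Proof.
move=> su sv uv; rewrite leNgt; apply/negP => lt.
set N := nrm (_ + _) in lt; have N0 : 0 <= N by exact: nrm_ge0.
pose c := Num.sqrt ((N + nrm u ^+ 2) / 2).
have c2 : c ^+ 2 = (N + nrm u ^+ 2) / 2 by rewrite sqr_sqrtr; lra.
have c0 : 0 < c by rewrite sqrtr_gt0; lra.
have : nrm (c^-1%:C *: u) <= 1.
  apply: (@nrm_sum_sqr1 _ (c^-1%:C *: v)); rewrite ?star_scaler ?su ?sv//.
    by apply/commutesZ/commutes_sym/commutesZ/commutes_sym.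
  rewrite !scaler_smul -scalerDr nrmZr ger0_norm; last first.
    by rewrite mulr_ge0// invr_ge0 ltW.
  by rewrite -invfM -expr2 ler_pdivrMl ?exprn_gt0// mulr1 -/N c2; lra.
rewrite nrmZr gtr0_norm ?invr_gt0// ler_pdivrMl// mulr1 => uc.
have : nrm u ^+ 2 <= c ^+ 2 by rewrite ler_pXn2r ?nnegrE ?nrm_ge0 ?sqrtr_ge0.
by rewrite c2; lra.
Qed.

(** With r = p^2, a = s^2 and d = r - a, the sum of (d p)^2 and (d s)^2 is
d (r^2 - a^2) = 0, so both squares vanish, and with them d r and d a. *)
Lemma pos_sqrt_unique p s : star p = p -> star s = s -> commutes p s ->
  (p ** p) ** (p ** p) = (s ** s) ** (s ** s) -> p ** p = s ** s.
Proof.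
move=> sp ss ps; set r := p ** p; set a := s ** s => ra.
have sp' : commutes s p by exact: commutes_sym.
have ar : commutes r a by apply: commutesM; apply: commutes_sym; exact: commutesM.
pose d := r - a.
have dp : commutes d p by apply: commutesB; exact: commutesM.
have ds : commutes d s by apply: commutesB; exact: commutesM.
have sd : star d = d by rewrite starB !starM sp ss.
have dra : d ** (r + a) = 0.
  by rewrite smulBl !smulDr ra ar [a ** r + _]addrC subrr.
have sum0 : (d ** p) ** (d ** p) + (d ** s) ** (d ** s) = 0.
  by rewrite !commutes_sqr// -smulDr -smulA dra smulx0.
have z x y : star x = x -> star y = y -> commutes x y -> x ** x + y ** y = 0 -> x = 0.
  move=> sx sy xy xy0; have := nrm_sum_sqr sx sy xy; rewrite xy0 nrm0.
  rewrite -nrm_sqr// => /nrm_le0_eq0 xx0.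
  by apply: starM_eq0; rewrite sx.
have sdp := star_commutesM sd sp dp; have sds := star_commutesM sd ss ds.
have dpds : commutes (d ** p) (d ** s).
  by apply: commutesM; apply: commutes_sym; apply: commutesM => //; exact: commutes_sym.
have dp0 := z _ _ sdp sds dpds sum0.
have ds0 : d ** s = 0.
  by apply: z sds sdp (commutes_sym dpds) _; rewrite addrC.
apply/eqP; rewrite -subr_eq0 -/d; apply/eqP/starM_eq0.
by rewrite sd {2}/d smulBr /r /a !smulA dp0 ds0 !smul0x subrr.
Qed.

End Unital.

(** * Homomorphisms of C*-algebras *)

Definition star_hom_on (K : numClosedFieldType) (A B : starAlgType K)
    (P : set A) (f : A -> B) : Prop :=
  [/\ forall x y, P x -> P y -> f (x + y) = f x + f y,
      forall a x, P x -> f (a *: x) = a *: f x,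
      forall x y, P x -> P y -> f (x ** y) = f x ** f y &
      forall x, P x -> f (star x) = star (f x)].

Lemma star_hom_comp (K : numClosedFieldType) (A B C : starAlgType K)
    (P : set A) (f : A -> B) (g : B -> C) :
  star_hom_on P f -> star_hom g -> star_hom_on P (g \o f).
Proof.
move=> [fD fZ fM fS] gH; split => [x y Px Py|a x Px|x y Px Py|x Px] /=.
- by rewrite fD// (star_homD gH).
- by rewrite fZ// (star_homZ gH).
- by rewrite fM// (star_homM gH).
- by rewrite fS// (star_homS gH).
Qed.

Lemma sub_cstarT (R : realType) (A : cstarAlgType R) : sub_cstar [set: A].
Proof. by split => //; exact: closedT. Qed.

Section SelfAdjointBound.
Context {R : realType} {A B : cstarAlgType R} (P : set A) (PP : sub_cstar P).

(** By the C*-identity, a comparison of C*-seminorms need only be checked on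
the self-adjoint elements of the unit ball. *)
Lemma sa_bound (p q : A -> R) :
  (forall x, 0 <= p x) -> (forall x, 0 <= q x) ->
  (forall x, P x -> p (star x ** x) = p x ^+ 2) ->
  (forall x, P x -> q (star x ** x) = q x ^+ 2) ->
  (forall (c : R) x, P x -> p (c%:C *: x) = `|c| * p x) ->
  (forall (c : R) x, P x -> q (c%:C *: x) = `|c| * q x) ->
  (forall x, P x -> star x = x -> q x <= 1 -> p x <= 1) ->
  forall x, P x -> p x <= q x.
Proof.
move=> p0 q0 pC qC pZ qZ pq x Px.
rewrite -(@ler_pXn2r _ 2) ?nnegrE// -pC// -qC//.
have {Px} : P (star x ** x).
  by apply: (sub_cstarM PP) => //; exact: (sub_cstar_star PP).
have : star (star x ** x) = star x ** x by rewrite starM starK.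
move: (star x ** x) => y sy Py.
rewrite leNgt; apply/negP => lt.
pose c := (p y + q y) / 2.
have c0 : 0 < c by have := q0 y; rewrite /c; lra.
have : p (c^-1%:C *: y) <= 1.
  apply: pq; first exact: (sub_cstarZ PP).
    by rewrite star_scaler sy.
  by rewrite qZ// gtr0_norm ?invr_gt0// ler_pdivrMl// mulr1 /c; lra.
by rewrite pZ// gtr0_norm ?invr_gt0// ler_pdivrMl// mulr1 /c; lra.
Qed.

End SelfAdjointBound.

Section Homomorphisms.
Context {R : realType}.
Implicit Types A B : cstarAlgType R.

(** For y self-adjoint of norm at most 1, let w = 1 - sqrt (1 - y^2), an element
of P. The images of y and of w are self-adjoint and commute, and f y lies on the
unit circle with 1 - f w. *)
Lemma hom_contractive A B (P : set A) (f : A -> B) :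
  sub_cstar P -> star_hom_on P f -> forall x, P x -> nrm (f x) <= nrm x.
Proof.
move=> PP fH; have := star_hom_comp fH star_hom_incl.
set g := _ \o f => -[gD gZ gM gS].
suff gc x : P x -> nrm (g x) <= nrm x by move=> x /gc; rewrite /g/= nrm_incl.
apply: (sa_bound PP (p := fun x => nrm (g x)) (q := nrm)) => //;
  try by move=> *; exact: nrm_ge0.
- by move=> y Py; rewrite gM ?gS ?nrm_cstar//; exact: (sub_cstar_star PP).
- by move=> y _; exact: nrm_cstar.
- by move=> c y Py; rewrite gZ// nrmZr.
- by move=> c y _; exact: nrmZr.
move=> {}x Px sx x1.
have [||w [_ ww sw _ wP]] := @sqrt_iter_lim R A (x ** x).
- by rewrite starM sx.
- by rewrite nrm_sqr// expr_le1 ?nrm_ge0.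
have Pxx : P (x ** x) by exact: (sub_cstarM PP).
have Pw : P w by exact: wP.
have xw : commutes w x by apply: (wP _ (sub_cstar_commutes sx)); exact: commutesM.
apply: (@nrm_circle _ _ mult_one (@mult_1m _ _) (@mult_m1 _ _) (g x)
  (mult_one - g w)) => //.
- by rewrite -gS// sx.
- by rewrite starB (star_one (@mult_1m _ _) (@mult_m1 _ _)) -gS// sw.
- apply/commutes_sym/commutesB; first exact: (commutes_one (@mult_1m _ _) (@mult_m1 _ _)).
  by rewrite /commutes -!gM// xw.
- rewrite (one_sub_sqr (@mult_1m _ _) (@mult_m1 _ _) (h := g (x ** x))).
    by rewrite -gM// addrC subrK.
  by rewrite -gD// ww gD// ?gM//; exact: (sub_cstarM PP).
Qed.

Section Injective.
Context {A C : cstarAlgType R} (P : set A) (f : A -> C).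
Hypotheses (PP : sub_cstar P) (fH : star_hom_on P f).
Let fD x y : P x -> P y -> f (x + y) = f x + f y.
Proof. by case: fH => + _ _ _; exact. Qed.

Let fZ a x : P x -> f (a *: x) = a *: f x.
Proof. by case: fH => _ + _ _; exact. Qed.

Let fM x y : P x -> P y -> f (x ** y) = f x ** f y.
Proof. by case: fH => _ _ + _; exact. Qed.

Let fS x : P x -> f (star x) = star (f x).
Proof. by case: fH => _ _ _; exact. Qed.


Let fB x y : P x -> P y -> f (x - y) = f x - f y.
Proof.
move=> Px Py; have Py' : P (-1 *: y) by exact: (sub_cstarZ PP).
by rewrite -[- y]scaleN1r fD// fZ// scaleN1r.
Qed.

(** The pairs of multipliers intertwined by f; a substitute for the extension
   of f to an algebra with unit. *)
Let twined (m : multiplier A) (n : multiplier C) : Prop :=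
  forall x, P x -> P (lmult m x) /\ f (lmult m x) = lmult n (f x).

Let twinedZ a m n : twined m n -> twined (a *: m) (a *: n).
Proof.
move=> mn x Px; have [Pm fm] := mn _ Px; split; first exact: (sub_cstarZ PP).
by rewrite /= fZ// fm.
Qed.

Let twinedD m n m' n' : twined m n -> twined m' n' -> twined (m + m') (n + n').
Proof.
move=> mn mn' x Px; have [Pm fm] := mn _ Px; have [Pm' fm'] := mn' _ Px.
by split; [exact: (sub_cstarD PP) | rewrite /= fD// fm fm'].
Qed.

Let twinedB m n m' n' : twined m n -> twined m' n' -> twined (m - m') (n - n').
Proof.
move=> mn mn'; rewrite -[- m']scaleN1r -[- n']scaleN1r.
by apply: twinedD => //; exact: twinedZ.
Qed.

Let twinedM m n m' n' : twined m n -> twined m' n' -> twined (m ** m') (n ** n').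
Proof.
move=> mn mn' x Px; have [Pm' fm'] := mn' _ Px; have [Pm fm] := mn _ Pm'.
by split => //; rewrite /= fm fm'.
Qed.

Let twined1 : twined mult_one mult_one.
Proof. by []. Qed.

Let twined_incl x : P x -> twined (mult_incl x) (mult_incl (f x)).
Proof. by move=> Px y Py; split; [exact: (sub_cstarM PP) | exact: fM]. Qed.

Let twined_sqrt_iter m n k : twined m n -> twined (sqrt_iter m k) (sqrt_iter n k).
Proof.
move=> mn; elim: k => [|k IH] x Px /=.
  split; first exact: (sub_cstar0 PP).
  by rewrite -(scale0r (0 : A)) fZ ?scale0r//; exact: (sub_cstar0 PP).
by apply: (twinedZ _ (twinedD mn (twinedM IH IH))) Px.
Qed.

Let cvs_lmult (D : cstarAlgType R) (u : nat -> multiplier D) m x :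
  cvs u m -> cvs (fun k => lmult (u k) x) (lmult m x).
Proof.
apply: (cvs_lip (f := fun n => lmult n x) (K := nrm x)) => n.
have -> : lmult n x - lmult m x = lmult (n - m) x.
  by rewrite -[RHS]/(lmult n x + (-1) *: lmult m x) scaleN1r.
by rewrite mulrC nrm_lmult.
Qed.

Let twined_cvs (u : nat -> multiplier A) (v : nat -> multiplier C) m n :
  (forall k, twined (u k) (v k)) -> cvs u m -> cvs v n -> twined m n.
Proof.
move=> uv um vn x Px.
have ux := cvs_lmult x um.
have Pm : P (lmult m x).
  apply: closed_cvs (sub_cstar_closed PP) _ ux => k.
  by case: (uv k x Px).
split => //; apply: cvs_unique (cvs_lmult (f x) vn).
rewrite (_ : (fun k => _) = fun k => f (lmult (u k) x)); last first.
  by apply/funext => k; case: (uv k x Px).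
move=> c c0; have [N uN] := ux _ c0; exists N => k /uN; apply: le_lt_trans.
have Pu : P (lmult (u k) x) by case: (uv k x Px).
by rewrite -fB//; apply: (hom_contractive PP fH); exact: (sub_cstarB PP).
Qed.

Hypothesis f_inj : forall x, P x -> f x = 0 -> x = 0.

Let e1 (D : cstarAlgType R) := @mult_1m R D.
Let e2 (D : cstarAlgType R) := @mult_m1 R D.

(** 1 - w is the modulus of b and q the square root of this modulus. *)
Let modulus (D : cstarAlgType R) (b : multiplier D) :
  star b = b -> nrm b <= 1 -> exists w q,
  [/\ cvs (sqrt_iter (mult_one - b ** b)) w,
      star q = q, q ** q = mult_one - w, (q ** q) ** (q ** q) = b ** b &
      forall z, star z = z -> commutes b z -> commutes q z].
Proof.
move=> sb b1.
have [||w [hw ww sw w1 wP]] := @sqrt_iter_lim R (multiplier D) (mult_one - b ** b).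
- by rewrite starB (star_one (@e1 D) (@e2 D)) starM sb.
- exact: (nrm_one_sub_sqr (@e1 D) (@e2 D)).
have [q [sq qq qP]] := sqrt_one_sub (@e1 D) (@e2 D) sw w1.
exists w, q; split => //.
  by rewrite qq (one_sub_sqr (@e1 D) (@e2 D) ww) subKr.
move=> z sz bz; apply: qP => //; apply: (wP _ (sub_cstar_commutes sz)).
by apply: commutesB; [exact: (commutes_one (@e1 D) (@e2 D)) | exact: commutesM].
Qed.

(** Take y self-adjoint with f y of norm at most 1 and put a = y^2 - y^4. In the target a becomes positive,
hence equal to its modulus; the modulus is a limit of polynomials, so
injectivity gives a = |a| in the domain too, at least as multipliers of P. Then
y^4 = y^6 + y |a| y is a sum of two squares, so that |y|^6 <= |y|^4. *)
Lemma injective_hom_ge x : P x -> nrm x <= nrm (f x).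
Proof.
apply: (sa_bound PP (p := nrm) (q := fun x => nrm (f x))) => //;
  try by move=> *; exact: nrm_ge0.
- by move=> y _; exact: nrm_cstar.
- by move=> y Py; rewrite fM ?fS ?nrm_cstar//; exact: (sub_cstar_star PP).
- by move=> c y _; exact: nrmZr.
- by move=> c y Py; rewrite fZ// nrmZr.
move=> {x} y Py sy fy1.
have Pyy : P (y ** y) by exact: (sub_cstarM PP).
have Pa0 : P (y ** y - (y ** y) ** (y ** y)).
  by apply: (sub_cstarB PP) => //; exact: (sub_cstarM PP).
pose k : R := 1 + nrm (y ** y - (y ** y) ** (y ** y)).
have k1 : 1 <= k by rewrite lerDl nrm_ge0.
have k0 : 0 < k by lra.
(* eta^2 scales a into the unit ball. *)
pose eta := (Num.sqrt k)^-1.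
have eta0 : 0 < eta by rewrite invr_gt0 sqrtr_gt0.
have eta2 : eta * eta = k^-1 by rewrite -invfM -expr2 sqr_sqrtr ?ltW.
pose b := (eta * eta)%:C *: (y ** y - (y ** y) ** (y ** y)).
have Pb : P b by exact: (sub_cstarZ PP).
have sb : star b = b by rewrite star_scaler starB !starM sy.
have b1 : nrm b <= 1.
  rewrite nrmZr eta2 gtr0_norm ?invr_gt0// ler_pdivrMl// mulr1.
  by rewrite /k lerDr.
pose B := mult_incl b; pose B' := mult_incl (f b).
pose Y := mult_incl y; pose Y' := mult_incl (f y).
have iS (D : cstarAlgType R) (z : D) : star (mult_incl z) = mult_incl (star z).
  by rewrite (star_homS star_hom_incl).
have iM (D : cstarAlgType R) (z t : D) :
    mult_incl (z ** t) = mult_incl z ** mult_incl t.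
  by rewrite (star_homM star_hom_incl).
have sB : star B = B by rewrite iS sb.
have sB' : star B' = B' by rewrite iS -fS// sb.
have sY : star Y = Y by rewrite iS sy.
have sY' : star Y' = Y' by rewrite iS -fS// sy.
have [||w [q [hw sq qq qB qP]]] := @modulus A B => //; first by rewrite nrm_incl.
have [||w' [q' [hw' sq' qq' qB' qP']]] := @modulus C B' => //.
  by rewrite nrm_incl; apply: le_trans (hom_contractive PP fH Pb) _.
have [||t [st tt tP]] := @sqrt_one_sub R _ mult_one (@e1 C) (@e2 C) (Y' ** Y').
- by rewrite starM sY'.
- by rewrite -iM nrm_incl nrm_sqr -?fS// ?sy// expr_le1 ?nrm_ge0.
have tY : commutes t Y' by apply: tP => //; exact: commutesM.
(* f b is the square of v, as f a = (f y)^2 (1 - (f y)^2). *)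
pose v := eta%:C *: (Y' ** t).
have sv : star v = v.
  by rewrite star_scaler star_commutesM//; exact: commutes_sym.
have vv : v ** v = B'.
  rewrite scaler_smul commutes_sqr; last exact: commutes_sym.
  rewrite tt smulBr e2 /B' /b fZ// fB//; last exact: (sub_cstarM PP).
  rewrite (star_homZ star_hom_incl) (star_homD star_hom_incl) (star_homN star_hom_incl).
  by rewrite !fM// !iM.
have B'v : commutes B' v by rewrite -vv; exact: commutesM.
have q'B' : q' ** q' = B'.
  rewrite -vv; apply: (pos_sqrt_unique (@e1 C) (@e2 C)) => //.
    exact: qP'.
  by rewrite qB' vv.
(* The approximants of the two moduli are intertwined, hence so are the
   moduli. *)
have tw : twined w w'.
  apply: twined_cvs hw hw' => j; apply: twined_sqrt_iter.
  by apply: twinedB twined1 _; apply: twinedM; exact: twined_incl.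
have qb : (q ** q) ** Y = B ** Y.
  rewrite mult_mul_incl -iM; congr mult_incl.
  have twq : twined (q ** q) (q' ** q').
    by rewrite qq qq'; exact: twinedB.
  have [Pqy fqy] := twq _ Py.
  have Pby : P (b ** y) by exact: (sub_cstarM PP).
  apply/eqP; rewrite -subr_eq0; apply/eqP/f_inj; first exact: (sub_cstarB PP).
  by rewrite fB// fqy q'B' fM// subrr.
have qY : commutes q Y.
  apply: qP => //; rewrite /commutes -!iM; congr mult_incl.
  apply: commutesZ; apply: commutesB; first exact: commutesM.
  by apply: commutesM; exact: commutesM.
pose y3 := eta%:C *: (Y ** (Y ** Y)).
have cY : commutes (Y ** (Y ** Y)) Y by apply: commutesM; last exact: commutesM.
have sy3 : star y3 = y3 by rewrite star_scaler !starM !sY -smulA.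
have sYq : star (Y ** q) = Y ** q by apply: star_commutesM => //; exact: commutes_sym.
have y3q : commutes y3 (Y ** q).
  have y3Y : commutes y3 Y by exact: commutesZ.
  have y3q : commutes y3 q.
    by apply: commutesZ; apply: commutesM; [|apply: commutesM]; exact: commutes_sym.
  by apply: commutes_sym; apply: commutesM; exact: commutes_sym.
(* This is y^6 + y |a| y = y^4, scaled by eta^2. *)
have sum : y3 ** y3 + (Y ** q) ** (Y ** q) = (eta * eta)%:C *: (Y ** Y ** (Y ** Y)).
  have -> : (Y ** q) ** (Y ** q) = Y ** ((q ** q) ** Y).
    by rewrite -!smulA qY.
  rewrite qb scaler_smul /B /b (star_homZ star_hom_incl) (star_homD star_hom_incl).
  rewrite (star_homN star_hom_incl) !iM -/Y -scalersAl -scalersAr -scalerDr.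
  by congr (_ *: _); rewrite smulBl smulBr !smulA addrC subrK.
have := nrm_sum_sqr (@e1 A) (@e2 A) sy3 sYq y3q.
rewrite sum !nrmZr -!iM !nrm_incl.
rewrite (nrm_sqr (x := y ** y)); last by rewrite starM sy.
rewrite gtr0_norm// gtr0_norm ?mulr_gt0// exprMn -expr2 ler_pM2l ?exprn_gt0//.
rewrite nrm_sqr// => le3.
have [->|/eqP y0] := pselect (nrm y = 0); first exact: ler01.
have ny : 0 < nrm y by rewrite lt_def y0 nrm_ge0.
have le4 : nrm y ^+ 4 <= nrm y * nrm (y ** (y ** y)).
  have -> : nrm y ^+ 4 = nrm ((y ** y) ** (y ** y)).
    by rewrite !nrm_sqr ?starM ?sy// -exprM.
  by rewrite -smulA nrmM.
have n3 : nrm y ^+ 3 <= nrm (y ** (y ** y)).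
  by rewrite -(ler_pM2l ny) -exprS.
have : (nrm y ^+ 3) ^+ 2 <= (nrm y ^+ 2) ^+ 2.
  by apply: le_trans le3; rewrite ler_pXn2r ?nnegrE ?exprn_ge0 ?nrm_ge0.
rewrite ler_pXn2r ?nnegrE ?exprn_ge0 ?nrm_ge0// exprS -[leRHS]mul1r.
by rewrite ler_pM2r ?exprn_gt0.
Qed.

End Injective.
End Homomorphisms.

(** * Uniform closures of algebras of bounded families *)

Record famAlg (R : realType) (I : Type) (B : I -> cstarAlgType R) := FamAlg {
  fam :> (forall i, B i) -> Prop;
  fam0 : fam (fun=> 0);
  famD : forall f g, fam f -> fam g -> fam (fun i => f i + g i);
  famZ : forall (a : R[i]) f, fam f -> fam (fun i => a *: f i);
  famM : forall f g, fam f -> fam g -> fam (fun i => f i ** g i);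
  famS : forall f, fam f -> fam (fun i => star (f i));
  fam_bounded : forall f, fam f -> exists c : R, forall i, nrm (f i) <= c
}.

(** The families that are uniform limits of members of D; with the supremum
norm they form a C*-algebra. *)
Record uclosure (R : realType) (I : Type) (B : I -> cstarAlgType R)
    (D : famAlg B) : Type := UClosure {
  ufam :> forall i, B i;
  ufamP : forall c : R, 0 < c ->
    exists2 g, D g & forall i, nrm (ufam i - g i) <= c
}.

Section UniformClosure.
#[local] Obligation Tactic := idtac.
Context {R : realType} {I : Type} {B : I -> cstarAlgType R} (D : famAlg B).
Implicit Types f g h : uclosure D.

Lemma uclosure_ext f g : (forall i, f i = g i) -> f = g.
Proof.
case: f g => f fP [g gP] /= fg.
have {}fg : f = g by exact: functional_extensionality_dep.
by subst g; f_equal; exact: Prop_irrelevance.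
Qed.

HB.instance Definition _ := gen_eqMixin (uclosure D).
HB.instance Definition _ := gen_choiceMixin (uclosure D).

Lemma uclosure_bounded f : exists2 c : R, 0 <= c & forall i, nrm (f i) <= c.
Proof.
have [g Dg fg] := ufamP f ltr01; have [c gc] := fam_bounded Dg.
exists (`|c| + 1) => [|i]; first by rewrite addr_ge0.
rewrite (le_trans (nrm_le_dist _ (g i)))// lerD//.
by rewrite (le_trans (gc i))// ler_norm.
Qed.

Program Definition uzero : uclosure D := @UClosure R I B D (fun=> 0) _.
Next Obligation.
move=> c c0; exists (fun=> 0); first exact: fam0.
by move=> i; rewrite subrr nrm0 ltW.
Qed.

Program Definition uadd f g : uclosure D :=
  @UClosure R I B D (fun i => f i + g i) _.
Next Obligation.
move=> f g c c0; have c2 : 0 < c / 2 by rewrite divr_gt0.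
have [f' Df ff] := ufamP f c2; have [g' Dg gg] := ufamP g c2.
exists (fun i => f' i + g' i); first exact: famD.
move=> i; rewrite opprD addrACA (le_trans (nrmD _ _))//.
by rewrite [leRHS]splitr lerD.
Qed.

Program Definition uscale (a : R[i]) f : uclosure D :=
  @UClosure R I B D (fun i => a *: f i) _.
Next Obligation.
move=> a f c c0.
have a0 : 0 <= complex.Re `|a| by have := normr_ge0 a; rewrite lecE => /andP[].
have k0 : 0 < complex.Re `|a| + 1 by rewrite ltr_wpDl.
have [g Dg fg] := ufamP f (divr_gt0 c0 k0).
exists (fun i => a *: g i); first exact: famZ.
move=> i; rewrite -scalerBr nrmZ.
have := fg i; rewrite ler_pdivlMr//; apply: le_trans.
by rewrite mulrC ler_wpM2l ?nrm_ge0// lerDl.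
Qed.

Definition uopp f : uclosure D := uscale (-1) f.

Program Definition umul f g : uclosure D :=
  @UClosure R I B D (fun i => f i ** g i) _.
Next Obligation.
move=> f g c c0.
have [b b0 gb] := uclosure_bounded g; have [a a0 fa] := uclosure_bounded f.
pose e := Num.min 1 (c / 2 / (b + 1)).
have b1 : 0 < b + 1 by rewrite ltr_wpDl.
have a1 : 0 < a + 1 by rewrite ltr_wpDl.
have c2 : 0 < c / 2 by rewrite divr_gt0.
have e0 : 0 < e by rewrite lt_min ltr01 divr_gt0.
have [f' Df ff] := ufamP f e0.
have [g' Dg gg] := ufamP g (divr_gt0 c2 a1).
exists (fun i => f' i ** g' i); first exact: famM.
move=> i; have -> : f i ** g i - f' i ** g' i =
    (f i - f' i) ** g i + f' i ** (g i - g' i).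
  by rewrite smulBl smulBr addrA subrK.
rewrite (le_trans (nrmD _ _))// [leRHS]splitr.
apply: lerD; apply: le_trans (nrmM _ _) _.
  apply: (@le_trans _ _ (c / 2 / (b + 1) * (b + 1))); last by rewrite divfK ?gt_eqF.
  rewrite ler_pM ?nrm_ge0//; last by rewrite (le_trans (gb i))// lerDl.
  by rewrite (le_trans (ff i))// /e ge_min lexx orbT.
apply: (@le_trans _ _ ((a + 1) * (c / 2 / (a + 1)))); last first.
  by rewrite mulrC divfK ?gt_eqF.
rewrite ler_pM ?nrm_ge0//.
rewrite (le_trans (nrm_le_dist _ (f i)))// lerD// nrm_distC (le_trans (ff i))//.
by rewrite /e ge_min lexx.
Qed.

Program Definition ustar f : uclosure D :=
  @UClosure R I B D (fun i => star (f i)) _.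
Next Obligation.
move=> f c c0; have [g Dg fg] := ufamP f c0.
exists (fun i => star (g i)); first exact: famS.
by move=> i; rewrite -starB nrm_star.
Qed.

Let uaddA : associative uadd.
Proof. by move=> f g h; apply: uclosure_ext => i /=; rewrite addrA. Qed.

Let uaddC : commutative uadd.
Proof. by move=> f g; apply: uclosure_ext => i /=; rewrite addrC. Qed.

Let uadd0 : left_id uzero uadd.
Proof. by move=> f; apply: uclosure_ext => i /=; rewrite add0r. Qed.

Let uaddN : left_inverse uzero uopp uadd.
Proof. by move=> f; apply: uclosure_ext => i /=; rewrite scaleN1r addNr. Qed.

HB.instance Definition _ :=
  GRing.isZmodule.Build (uclosure D) uaddA uaddC uadd0 uaddN.

Let uscaleA a b f : uscale a (uscale b f) = uscale (a * b) f.
Proof. by apply: uclosure_ext => i /=; rewrite scalerA. Qed.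

Let uscale1 : left_id 1 uscale.
Proof. by move=> f; apply: uclosure_ext => i /=; rewrite scale1r. Qed.

Let uscaleDr : right_distributive uscale +%R.
Proof. by move=> a f g; apply: uclosure_ext => i /=; rewrite scalerDr. Qed.

Let uscaleDl f : {morph uscale^~ f : a b / a + b}.
Proof. by move=> a b; apply: uclosure_ext => i /=; rewrite scalerDl. Qed.

HB.instance Definition _ := GRing.Zmodule_isLmodule.Build R[i] (uclosure D)
  uscaleA uscale1 uscaleDr uscaleDl.

Let umulA : associative umul.
Proof. by move=> f g h; apply: uclosure_ext => i /=; rewrite smulA. Qed.

Let umulDl : left_distributive umul +%R.
Proof. by move=> f g h; apply: uclosure_ext => i /=; rewrite smulDl. Qed.

Let umulDr : right_distributive umul +%R.
Proof. by move=> f g h; apply: uclosure_ext => i /=; rewrite smulDr. Qed.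

Let uscaleAl (a : R[i]) f g : a *: umul f g = umul (a *: f) g.
Proof. by apply: uclosure_ext => i /=; rewrite scalersAl. Qed.

Let uscaleAr (a : R[i]) f g : a *: umul f g = umul f (a *: g).
Proof. by apply: uclosure_ext => i /=; rewrite scalersAr. Qed.

Let ustarK : involutive ustar.
Proof. by move=> f; apply: uclosure_ext => i /=; rewrite starK. Qed.

Let ustarD : {morph ustar : f g / f + g}.
Proof. by move=> f g; apply: uclosure_ext => i /=; rewrite starD. Qed.

Let ustarZ (a : R[i]) f : ustar (a *: f) = (a^* : R[i]) *: ustar f.
Proof. by apply: uclosure_ext => i /=; rewrite starZ. Qed.

Let ustarM f g : ustar (umul f g) = umul (ustar g) (ustar f).
Proof. by apply: uclosure_ext => i /=; rewrite starM. Qed.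

HB.instance Definition _ := Lmodule_isStarAlg.Build R[i] (uclosure D)
  umulA umulDl umulDr uscaleAl uscaleAr ustarK ustarD ustarZ ustarM.

(** Zero is added to the set for the sake of an empty index type. *)
Definition unorm f : R := sup [set r | r = 0 \/ exists i, r = nrm (f i)].

Let unorm_has_sup f : has_sup [set r | r = 0 \/ exists i, r = nrm (f i)].
Proof.
split; first by exists 0; left.
have [c c0 fc] := uclosure_bounded f.
by exists c => _ /= [->//|[i ->]].
Qed.

Let unorm_le f i : nrm (f i) <= unorm f.
Proof. by apply: (ub_le_sup (proj2 (unorm_has_sup f))); right; exists i. Qed.

Let unorm_ge0 f : 0 <= unorm f.
Proof. by apply: (ub_le_sup (proj2 (unorm_has_sup f))); left. Qed.

Let unorm_min f (c : R) : 0 <= c -> (forall i, nrm (f i) <= c) -> unorm f <= c.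
Proof.
move=> c0 fc; apply: (ge_sup (proj1 (unorm_has_sup f))) => _ /= [->//|[i ->]].
exact: fc.
Qed.

Let unormD f g : unorm (f + g) <= unorm f + unorm g.
Proof.
apply: unorm_min => [|i]; first by rewrite addr_ge0.
by rewrite (le_trans (nrmD _ _))// lerD.
Qed.

Let unormZ (a : R[i]) f : unorm (a *: f) <= complex.Re `|a| * unorm f.
Proof.
have a0 : 0 <= complex.Re `|a| by have := normr_ge0 a; rewrite lecE => /andP[].
apply: unorm_min => [|i]; first by rewrite mulr_ge0.
by rewrite nrmZ ler_wpM2l.
Qed.

Let unorm0 f : unorm f = 0 -> f = 0.
Proof.
move=> f0; apply: uclosure_ext => i; apply: nrm_le0_eq0.
by rewrite (le_trans (unorm_le _ _))// f0.
Qed.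

Let unormM f g : unorm (f ** g) <= unorm f * unorm g.
Proof.
apply: unorm_min => [|i]; first by rewrite mulr_ge0.
by rewrite (le_trans (nrmM _ _))// ler_pM ?nrm_ge0.
Qed.

Let unormC f : unorm f ^+ 2 <= unorm (star f ** f).
Proof.
rewrite -[leRHS]sqr_sqrtr// ler_pXn2r ?nnegrE ?sqrtr_ge0//.
apply: unorm_min => [|i]; first exact: sqrtr_ge0.
rewrite -(@ler_pXn2r _ 2) ?nnegrE ?nrm_ge0 ?sqrtr_ge0// sqr_sqrtr//.
by rewrite -nrm_cstar; exact: (unorm_le (star f ** f)).
Qed.

Let ufamB f g i : (f - g) i = f i - g i.
Proof. by rewrite -[LHS]/(f i + (-1) *: g i) scaleN1r. Qed.

Let unorm_complete (u : nat -> uclosure D) :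
  (forall c : R, 0 < c -> exists N, forall m n,
     (N <= m)%N -> (N <= n)%N -> unorm (u m - u n) < c) ->
  exists l, forall c : R, 0 < c -> exists N, forall n,
     (N <= n)%N -> unorm (u n - l) < c.
Proof.
move=> uc.
have pt i : exists l, cvs (fun n => u n i) l.
  apply: cauchys_cvs => c c0; have [N uN] := uc _ c0.
  exists N => m n Nm Nn; rewrite -ufamB.
  by apply: le_lt_trans (unorm_le _ _) (uN _ _ Nm Nn).
pose l i := projT1 (cid (pt i)).
have ul i : cvs (fun n => u n i) (l i) := projT2 (cid (pt i)).
have unif c : 0 < c -> exists N, forall n, (N <= n)%N ->
    forall i, nrm (u n i - l i) <= c.
  move=> c0; have [N uN] := uc _ c0; exists N => n Nn i.
  rewrite nrm_distC.
  apply: (cvs_nrm_le (N := N) (u := fun k => u k i - u n i)) => [k Nk|].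
    by rewrite -ufamB (le_trans (unorm_le _ _))// ltW// uN.
  by apply: cvsD => //; exact: cvs_cst.
have lP c : 0 < c -> exists2 g, D g & forall i, nrm (l i - g i) <= c.
  move=> c0; have c2 : 0 < c / 2 by rewrite divr_gt0.
  have [N uN] := unif _ c2; have [g Dg gu] := ufamP (u N) c2.
  exists g => // i; rewrite (le_trans (nrm_dist_trans (u N i) _ _))//.
  by rewrite nrm_distC [leRHS]splitr lerD// uN.
exists (UClosure lP) => c c0; have c2 : 0 < c / 2 by rewrite divr_gt0.
have [N uN] := unif _ c2; exists N => n Nn.
apply: (@le_lt_trans _ _ (c / 2)); last by lra.
by apply: unorm_min => [|i]; [exact: ltW | rewrite ufamB uN].
Qed.

HB.instance Definition _ := StarAlg_isCStarAlg.Build R (uclosure D)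
  unormD unormZ unorm0 unormM unormC unorm_complete.

Lemma nrm_ufam f i : nrm (f i) <= nrm f.
Proof. exact: unorm_le. Qed.

Lemma nrm_uclosure f (c : R) : 0 <= c -> (forall i, nrm (f i) <= c) -> nrm f <= c.
Proof. exact: unorm_min. Qed.

Program Definition uincl (f : forall i, B i) (Df : D f) : uclosure D := @UClosure R I B D f _.
Next Obligation.
by move=> f Df c c0; exists f => // i; rewrite subrr nrm0 ltW.
Qed.

End UniformClosure.

(** * Extension from dense families *)

Section Approximation.
Context {R : realType}.

Lemma cvs_approx (T : Type) (V : normedModType R[i]) (E : T -> V) (g : V) :
  (forall c : R, 0 < c -> exists t, nrm (g - E t) < c) ->
  exists u : nat -> T, cvs (E \o u) g.
Proof.
move=> gE.
have e0 n : 0 < (n.+1%:R^-1 : R) by rewrite invr_gt0.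
exists (fun n => projT1 (cid (gE _ (e0 n)))) => c c0.
exists (Num.truncn c^-1) => n Nn /=.
rewrite nrm_distC; apply: lt_trans (projT2 (cid (gE _ (e0 n)))) _.
rewrite invf_plt ?posrE//; apply: lt_le_trans (truncnS_gt _) _.
by rewrite ler_nat ltnS.
Qed.

Lemma cvs_transfer (T : Type) (V : normedModType R[i])
    (W : completeNormedModType R[i]) (E : T -> V) (F : T -> W)
    (u : nat -> T) (g : V) :
  (forall s t, nrm (F s - F t) = nrm (E s - E t)) ->
  cvs (E \o u) g -> exists h, cvs (F \o u) h.
Proof.
move=> EF ug; apply: cauchys_cvs => c c0.
have c2 : 0 < c / 2 by rewrite divr_gt0.
have [N uN] := ug _ c2; exists N => m n /uN /= mN /uN /= nN.
rewrite EF; apply: le_lt_trans (nrm_dist_trans g _ _) _.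
by rewrite (nrm_distC g) [ltRHS]splitr ltrD.
Qed.

Lemma closed_range (V : normedModType R[i]) (W : completeNormedModType R[i])
    (f : W -> V) :
  (forall x y, nrm (f x - f y) = nrm (x - y)) -> closed (range f).
Proof.
move=> fI; apply/closed_nrm => g gP.
have gf c : 0 < c -> exists t, nrm (g - f t) < c.
  by move=> /gP[_ [t _ <-] gt]; exists t.
have [u ug] := cvs_approx gf.
have [h uh] := cvs_transfer (F := id) (fun s t => esym (fI s t)) ug.
exists h => //; apply: cvs_unique ug.
by apply: (cvs_lip (K := 1)) uh => x; rewrite mul1r fI.
Qed.

(** Elements of V and W correspond to each other when they are the limits of E
and of F along a common sequence. As E and F induce the same distance, this
relation is the graph of a bijection; it is compatible with the operations
because limits are. *)
Lemma dense_star_iso (T : Type) (V W : cstarAlgType R) (E : T -> V) (F : T -> W)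
    (tZD : R[i] -> T -> T -> T) (tM : T -> T -> T) (tS : T -> T) :
  (forall s t, nrm (F s - F t) = nrm (E s - E t)) ->
  (forall g (c : R), 0 < c -> exists t, nrm (g - E t) < c) ->
  (forall h (c : R), 0 < c -> exists t, nrm (h - F t) < c) ->
  (forall a s t, E (tZD a s t) = a *: E s + E t) ->
  (forall a s t, F (tZD a s t) = a *: F s + F t) ->
  {morph E : s t / tM s t >-> s ** t} -> {morph F : s t / tM s t >-> s ** t} ->
  {morph E : s / tS s >-> star s} -> {morph F : s / tS s >-> star s} ->
  exists f : V -> W, star_iso f /\ forall t, f (E t) = F t.
Proof.
move=> EF dE dF EZ FZ EM FM ES FS.
pose rel g h := exists u, cvs (E \o u) g /\ cvs (F \o u) h.
have relr g : exists h, rel g h.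
  have [u ug] := cvs_approx (dE g); have [h uh] := cvs_transfer EF ug.
  by exists h, u.
have rell h : exists g, rel g h.
  have [u uh] := cvs_approx (dF h).
  have [g ug] := cvs_transfer (fun s t => esym (EF s t)) uh.
  by exists g, u.
have FE s t : nrm (E s - E t) = nrm (F s - F t) by [].
have lim_det (V' W' : cstarAlgType R) (E' : T -> V') (F' : T -> W') u v g h h' :
    (forall s t, nrm (F' s - F' t) = nrm (E' s - E' t)) ->
    cvs (E' \o u) g -> cvs (F' \o u) h -> cvs (E' \o v) g -> cvs (F' \o v) h' ->
    h = h'.
  move=> EF' ug uh vg vh'; apply: cvs_unique uh _ => c c0.
  have c3 : 0 < c / 3 by rewrite divr_gt0.
  have [N1 uN] := ug _ c3; have [N2 vN] := vg _ c3; have [N3 hN] := vh' _ c3.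
  exists (maxn N1 (maxn N2 N3)) => n; rewrite !geq_max.
  move=> /and3P[/uN un /vN vn /hN hn].
  rewrite /= in un vn hn *.
  apply: le_lt_trans (nrm_dist_trans (F' (v n)) _ _) _.
  have := nrm_dist_trans g (E' (u n)) (E' (v n)).
  by rewrite EF' (nrm_distC g); lra.
pose f g := projT1 (cid (relr g)).
have frel g : rel g (f g) := projT2 (cid (relr g)).
have relf g h : rel g h -> f g = h.
  move=> [u [ug uh]]; have [v [vg vh]] := frel g.
  exact: lim_det EF vg vh ug uh.
have cst t : rel (E t) (F t) by exists (fun=> t); split; exact: cvs_cst.
exists f; split; last by move=> t; exact: relf.
split; first split.
- move=> a x y; have [u [ux fu]] := frel x; have [v [vy fv]] := frel y.
  apply: relf; exists (fun n => tZD a (u n) (v n)); split.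
    rewrite (_ : _ \o _ = fun n => a *: (E \o u) n + (E \o v) n).
      by apply: cvsD => //; exact: cvsZ.
    by apply/funext => n /=.
  rewrite (_ : _ \o _ = fun n => a *: (F \o u) n + (F \o v) n).
    by apply: cvsD => //; exact: cvsZ.
  by apply/funext => n /=.
- move=> x y; have [u [ux fu]] := frel x; have [v [vy fv]] := frel y.
  apply: relf; exists (fun n => tM (u n) (v n)); split.
    rewrite (_ : _ \o _ = fun n => (E \o u) n ** (E \o v) n); first exact: cvsM.
    by apply/funext => n /=.
  rewrite (_ : _ \o _ = fun n => (F \o u) n ** (F \o v) n); first exact: cvsM.
  by apply/funext => n /=.
- move=> x; have [u [ux fu]] := frel x.
  apply: relf; exists (tS \o u); split.
    rewrite (_ : _ \o _ = fun n => star ((E \o u) n)); first exact: cvs_star.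
    by apply/funext => n /=.
  rewrite (_ : _ \o _ = fun n => star ((F \o u) n)); first exact: cvs_star.
  by apply/funext => n /=.
pose k h := projT1 (cid (rell h)).
have krel h : rel (k h) h := projT2 (cid (rell h)).
exists k => [g|h]; last exact: relf.
have [u [ug uh]] := frel g; have [v [vg vh]] := krel (f g).
exact: (lim_det _ _ _ _ _ _ _ _ _ FE vh vg uh ug).
Qed.

End Approximation.

(** * Formal sums of homogeneous elements *)

Section FormalSums.
Context {R : realType} {d : Order.disp_t} {L : meetSemilatticeType d}.
Context {A : L -> cstarAlgType R}.
Local Notation homog := {i : L & A i}.
Implicit Types (p q : homog) (s t : seq homog).

(** A formal sum is a sequence of homogeneous elements; the value of the
   product on homogeneous elements is the parameter pm of fmul. *)
Definition fscale (a : R[i]) s : seq homog :=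
  [seq Tagged A (a *: tagged p) | p <- s].

Definition fstar s : seq homog := [seq Tagged A (star (tagged p)) | p <- s].

Definition fmul (pm : homog -> homog -> homog) s t : seq homog :=
  [seq pm p q | p <- s, q <- t].

Section Evaluation.
Context {V : starAlgType R[i]} (e : forall i, A i -> V).
Hypothesis eH : forall i, star_hom (@e i).

Definition ev s : V := \sum_(p <- s) e (tagged p).

Lemma ev_cons p s : ev (p :: s) = e (tagged p) + ev s.
Proof. by rewrite /ev big_cons. Qed.

Lemma ev_cat s t : ev (s ++ t) = ev s + ev t.
Proof. by rewrite /ev big_cat. Qed.

Lemma ev_scale a s : ev (fscale a s) = a *: ev s.
Proof.
rewrite /ev big_map scaler_sumr; apply: eq_bigr => p _ /=.
by rewrite (star_homZ (eH (tag p))).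
Qed.

Lemma ev_star s : ev (fstar s) = star (ev s).
Proof.
rewrite /ev big_map (big_morph star (@starD _ V) (@star_0 _ V)).
by apply: eq_bigr => p _ /=; rewrite (star_homS (eH (tag p))).
Qed.

Lemma ev_mul pm s t :
  (forall p q, e (tagged p) ** e (tagged q) = e (tagged (pm p q))) ->
  ev (fmul pm s t) = ev s ** ev t.
Proof.
move=> eM; rewrite /ev /fmul big_allpairs_dep.
rewrite (big_morph (fun x => x ** _) (fun x y => smulDl x y _) (smul0x _)).
apply: eq_bigr => p _.
rewrite (big_morph (fun x => _ ** x) (fun x y => smulDr _ x y) (smulx0 _)).
by apply: eq_bigr => q _; rewrite eM.
Qed.

(** Terms of degree other than i contribute the default value 0. *)
Definition coef s i : A i := \sum_(p <- s) tagged_as (Tagged A (0 : A i)) p.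

Lemma tagged_as_ne i p : i != tag p -> tagged_as (Tagged A (0 : A i)) p = 0.
Proof. by move=> ip; rewrite /tagged_as; case: eqP => // E; case/eqP: ip. Qed.

Lemma ev_coef s (F : seq L) : uniq F -> {subset [seq tag p | p <- s] <= F} ->
  ev s = \sum_(i <- F) e (coef s i).
Proof.
move=> uF sF; rewrite /coef.
under eq_bigr => i _.
  rewrite (big_morph (@e i) (star_homD (eH i)) (star_hom0 (eH i))); over.
rewrite exchange_big /= /ev big_seq [RHS]big_seq; apply: eq_bigr => -[i a] ps.
rewrite (bigD1_seq i)//=; last by apply: sF; apply/mapP; exists (Tagged A a).
rewrite big1 => [|j ji]; last first.
  by rewrite tagged_as_ne ?(star_hom0 (eH j)).
by rewrite (tagged_asE (u := Tagged A (0 : A i))) addr0.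
Qed.

Lemma ev_eq0_coef s : (forall i, coef s i = 0) -> ev s = 0.
Proof.
move=> s0; rewrite (@ev_coef s (undup [seq tag p | p <- s])) ?undup_uniq//.
  by rewrite big1 // => i _; rewrite s0 (star_hom0 (eH i)).
by move=> i; rewrite mem_undup.
Qed.

End Evaluation.
End FormalSums.

(** * Finite subsets of a semilattice *)

Lemma ex_maximal (d : Order.disp_t) (L : porderType d) (F : seq L) :
  F != [::] -> exists2 i, i \in F & forall j, j \in F -> (i <= j)%O -> j = i.
Proof.
elim: F => // x F IH _; have [->|/IH[i iF im]] := eqVneq F [::].
  by exists x; rewrite ?mem_head// => j; rewrite inE => /eqP.
have [ix|nix] := boolP (i <= x)%O; last first.
  exists i => [|j]; rewrite inE ?iF ?orbT// => /orP[/eqP-> ix|]; last exact: im.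
  by rewrite ix in nix.
exists x => [|j]; first exact: mem_head.
rewrite inE => /orP[/eqP//|jF xj].
have ji := im _ jF (le_trans ix xj); rewrite ji in xj *.
by apply/eqP; rewrite eq_le ix xj.
Qed.

(** The meets of the nonempty subsequences of F. *)
Fixpoint meets (d : Order.disp_t) (L : meetSemilatticeType d) (F : seq L) : seq L :=
  if F is i :: F' then i :: meets F' ++ [seq (i `&` j)%O | j <- meets F']
  else [::].

Lemma sub_meets (d : Order.disp_t) (L : meetSemilatticeType d) (F : seq L) :
  {subset F <= meets F}.
Proof.
elim: F => //= i F IH j; rewrite !inE mem_cat => /orP[->//|/IH->].
by rewrite orbT.
Qed.

Lemma meets_closed (d : Order.disp_t) (L : meetSemilatticeType d) (F : seq L) i j :
  i \in meets F -> j \in meets F -> (i `&` j)%O \in meets F.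
Proof.
elim: F i j => //= x F IH i j; rewrite !inE !mem_cat.
have mx k : k \in meets F -> (x `&` k)%O \in [seq (x `&` j)%O | j <- meets F].
  by move=> kF; apply/mapP; exists k.
move=> /or3P[/eqP->|iF|/mapP[k kF ->]] /or3P[/eqP->|jF|/mapP[l lF ->]].
- by rewrite meetxx eqxx.
- by rewrite mx ?orbT.
- by rewrite meetA meetxx mx ?orbT.
- by rewrite meetC mx ?orbT.
- by rewrite IH ?orbT.
- by rewrite meetCA mx ?orbT ?IH.
- by rewrite meetC meetA meetxx mx ?orbT.
- by rewrite -meetA mx ?orbT ?IH.
- by rewrite meetACA meetxx mx ?orbT ?IH.
Qed.

(** * The graded algebra of a family of structure morphisms *)

Section Construction.
Context {R : realType} {d : Order.disp_t} {L : meetSemilatticeType d}.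
Context {A : L -> cstarAlgType R}.
Context {phi : forall i j : L, (i <= j)%O -> A j -> multiplier (A i)}.
Hypothesis phi_hom : forall (i j : L) (hij : (i <= j)%O), star_hom (phi hij).
Hypothesis phi_id : forall (i : L) (x : A i), phi (lexx i) x = mult_incl x.
Hypothesis phi_mul : forall (i j m : L) (hm : (m <= i `&` j)%O) (x : A i) (y : A j),
  exists2 z : A (i `&` j)%O,
    phi (leIl i j) x ** phi (leIr j i) y = mult_incl z
  & phi hm z = phi (le_trans hm (leIl i j)) x ** phi (le_trans hm (leIr j i)) y.
Local Notation homog := {i : L & A i}.
Implicit Types (p q : homog) (s t : seq homog) (i j k m : L).

(** The coordinate in M(A_m) of an element of A_i. The value is 0 unless m <= i:
the components whose index is not above m span an ideal. *)
Definition coord m i (a : A i) : multiplier (A m) :=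
  if @idP (m <= i)%O is ReflectT h then phi h a else 0.

Lemma coord_le m i (h : (m <= i)%O) (a : A i) : coord m a = phi h a.
Proof.
rewrite /coord; case: {-}_ / idP => [h'|//].
by rewrite (Prop_irrelevance h' h).
Qed.

Lemma coord_nle m i (a : A i) : ~~ (m <= i)%O -> coord m a = 0.
Proof. by rewrite /coord => /negP nh; case: {-}_ / idP. Qed.

Lemma coord_id i (a : A i) : coord i a = mult_incl a.
Proof. by rewrite (coord_le (lexx i)) phi_id. Qed.

Lemma coord_hom m i : star_hom (@coord m i).
Proof.
have [h|nh] := boolP (m <= i)%O.
  have -> : @coord m i = phi h by apply/funext => a; exact: coord_le.
  exact: phi_hom.
have -> : @coord m i = fun=> 0 by apply/funext => a; exact: coord_nle.
split=> [a x y|x y|x]; first by rewrite scaler0 addr0.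
  by rewrite smulx0.
by rewrite star_0.
Qed.

Lemma coord_nrm m i (a : A i) : nrm (coord m a) <= nrm a.
Proof.
have fH := coord_hom m i.
have fP : star_hom_on setT (@coord m i).
  by split=> *; rewrite ?(star_homD fH) ?(star_homZ fH) ?(star_homM fH) ?(star_homS fH).
exact: (hom_contractive (sub_cstarT _) fP).
Qed.

Let prodP p q : exists z : A (tag p `&` tag q)%O,
  phi (leIl (tag p) (tag q)) (tagged p) ** phi (leIr (tag q) (tag p)) (tagged q)
    = mult_incl z.
Proof. by have [z zP _] := phi_mul (lexx _) (tagged p) (tagged q); exists z. Qed.

Definition hprod p q : homog := Tagged A (projT1 (cid (prodP p q))).

Lemma hprodP p q : phi (leIl (tag p) (tag q)) (tagged p) **
  phi (leIr (tag q) (tag p)) (tagged q) = mult_incl (tagged (hprod p q)).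
Proof. exact: projT2 (cid (prodP p q)). Qed.

(** Taking m = i /\ j in the second condition on the structure morphisms shows
that the product it provides does not depend on m. *)
Lemma coordM m p q :
  coord m (tagged p) ** coord m (tagged q) = coord m (tagged (hprod p q)).
Proof.
have [h|] := boolP (m <= tag p `&` tag q)%O.
  have [z zP zE] := phi_mul h (tagged p) (tagged q).
  have {zP} zq : z = tagged (hprod p q) by apply: incl_inj; rewrite -hprodP.
  rewrite (coord_le (le_trans h (leIl _ _))) (coord_le (le_trans h (leIr _ _))).
  by rewrite -zE zq (coord_le h).
move=> nh; rewrite (coord_nle (i := (tag p `&` tag q)%O))//.
rewrite lexI negb_and in nh; case/orP: nh => nh; rewrite (coord_nle _ nh).
  by rewrite smul0x.
by rewrite smulx0.
Qed.

Lemma ev_coord_nrm m s :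
  nrm (ev (coord m) s) <= \sum_(p <- s) nrm (tagged p).
Proof.
rewrite /ev; elim: s => [|p s IH]; first by rewrite !big_nil nrm0.
by rewrite !big_cons (le_trans (nrmD _ _))// lerD// coord_nrm.
Qed.

Definition finite_fams : famAlg (fun m => multiplier (A m)).
Proof.
apply: (@FamAlg R L _ (fun f => exists s, forall m, f m = ev (coord m) s)).
- by exists [::] => m; rewrite /ev big_nil.
- by move=> f g [s fs] [t gt]; exists (s ++ t) => m; rewrite ev_cat fs gt.
- move=> a f [s fs]; exists (fscale a s) => m.
  by rewrite ev_scale ?fs//; exact: coord_hom.
- move=> f g [s fs] [t gt]; exists (fmul hprod s t) => m.
  by rewrite ev_mul ?fs ?gt//; exact: coordM.
- move=> f [s fs]; exists (fstar s) => m.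
  by rewrite ev_star ?fs//; exact: coord_hom.
- move=> f [s fs]; exists (\sum_(p <- s) nrm (tagged p)) => m.
  by rewrite fs ev_coord_nrm.
Defined.

Definition galg : cstarAlgType R := uclosure finite_fams.

Lemma coord_fam i (a : A i) : finite_fams (fun m => coord m a).
Proof. by exists [:: Tagged A a] => m; rewrite /ev big_seq1. Qed.

Definition iota_ i (a : A i) : galg := uincl (coord_fam a).

Lemma iota_hom i : star_hom (@iota_ i).
Proof.
split=> [a x y|x y|x]; apply: uclosure_ext => m /=.
- by rewrite (star_homD (coord_hom m i)) (star_homZ (coord_hom m i)).
- by rewrite (star_homM (coord_hom m i)).
- by rewrite (star_homS (coord_hom m i)).
Qed.

Lemma iota_nrm i (a : A i) : nrm (iota_ a) = nrm a.
Proof.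
apply/eqP; rewrite eq_le; apply/andP; split.
  by apply: nrm_uclosure => [|m]; [exact: nrm_ge0 | exact: coord_nrm].
by rewrite -(nrm_incl a) -coord_id; exact: (nrm_ufam (iota_ a) i).
Qed.

Lemma iota_dist i (a b : A i) : nrm (iota_ a - iota_ b) = nrm (a - b).
Proof. by rewrite -(star_homN (iota_hom i)) -(star_homD (iota_hom i)) iota_nrm. Qed.

Lemma iota_inj i : injective (@iota_ i).
Proof.
move=> a b ab; apply/eqP; rewrite -subr_eq0; apply/eqP/nrm0_eq0.
by rewrite -iota_dist ab subrr nrm0.
Qed.

Lemma iotaM p q : iota_ (tagged p) ** iota_ (tagged q) = iota_ (tagged (hprod p q)).
Proof. by apply: uclosure_ext => m; exact: coordM. Qed.

Lemma ufam_sum m (I : Type) (r : seq I) (F : I -> galg) :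
  (\sum_(x <- r) F x : galg) m = \sum_(x <- r) F x m.
Proof. by elim: r => [|x r IH]; rewrite ?big_nil ?big_cons// -IH. Qed.

Lemma ev_iota s m : ev iota_ s m = ev (coord m) s.
Proof. exact: ufam_sum. Qed.

Lemma ufamB (f g : galg) m : (f - g) m = f m - g m.
Proof. by rewrite -[LHS]/(f m + (-1) *: g m) scaleN1r. Qed.

Lemma galg_dense (g : galg) (c : R) : 0 < c -> exists s, nrm (g - ev iota_ s) < c.
Proof.
move=> c0; have c2 : 0 < c / 2 by rewrite divr_gt0.
have [f [s fs] gf] := ufamP g c2; exists s.
apply: (@le_lt_trans _ _ (c / 2)); last by lra.
apply: nrm_uclosure => [|m]; first exact: ltW.
by rewrite ufamB ev_iota -fs; exact: gf.
Qed.

(** The coordinate at i vanishes on A_j unless i <= j, which for j in F means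
j = i. *)
Lemma split_maximal (F : seq L) i s : {subset [seq tag p | p <- s] <= F} ->
  (forall j, j \in F -> (i <= j)%O -> j = i) -> exists (a : A i) t,
  [/\ {subset [seq tag p | p <- t] <= [seq j <- F | j != i]},
      ev iota_ s = iota_ a + ev iota_ t & ev iota_ s i = mult_incl a].
Proof.
move=> + im; elim: s => [|[j b] s IH] sF.
  exists 0, [::]; split => //; first by rewrite (star_hom0 (iota_hom i)) add0r.
  by rewrite ev_iota /ev big_nil (star_hom0 star_hom_incl).
have [|a [t [tF sE si]]] := IH; first by move=> k ks; apply: sF; rewrite inE ks orbT.
have jF : j \in F by apply: sF; exact: mem_head.
have [ji|ji] := eqVneq j i.
  subst j; exists (b + a), t; split => //.
    by rewrite ev_cons sE (star_homD (iota_hom i)) addrA.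
  by rewrite ev_iota ev_cons -ev_iota si coord_id (star_homD star_hom_incl).
have nij : ~~ (i <= j)%O by apply/negP => /(im _ jF) /eqP; rewrite (negPf ji).
exists a, (Tagged A b :: t); split.
- move=> k /=; rewrite inE => /orP[/eqP->|/tF//].
  by rewrite mem_filter ji.
- by rewrite !ev_cons sE addrCA.
- by rewrite ev_iota ev_cons -ev_iota si coord_nle// add0r.
Qed.

Definition span_on (F : seq L) : set galg :=
  [set ev iota_ s | s in [set s | {subset [seq tag p | p <- s] <= F}]].

(** Induction on F: for i maximal in F, the coordinate at i shows that the limit
g has a component a of degree i, and g - a is a limit of sums over the remaining
indices. *)
Lemma span_on_closed F : closed (span_on F).
Proof.
have [n] := ubnP (size F); elim: n F => // n IH F Fn.
have [->|/ex_maximal[i iF im]] := eqVneq F [::].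
  apply/closed_nrm => g gP; exists [::] => //; rewrite /ev big_nil.
  apply/esym/nrm_le0_eq0/ler_addgt0Pr => c /gP[_ [s sF <-] gs].
  rewrite add0r ltW//; case: s sF gs => [_|p s sF]; last first.
    by have := sF (tag p); rewrite /= mem_head => /(_ isT).
  by rewrite /ev big_nil subr0.
pose F' := [seq j <- F | j != i].
have F'n : (size F' < n)%N.
  rewrite size_filter; move: Fn; rewrite ltnS; apply: leq_trans.
  rewrite -(count_predC (fun j => j != i) F) -addn1 leq_add2l -has_count.
  by apply/hasP; exists i => //=; rewrite eqxx.
have /closed_nrm cF' := IH F' F'n.
apply/closed_nrm => g gP.
have [a _ ga] : range (@mult_incl R (A i)) (g i).
  have /closed_nrm : closed (range (@mult_incl R (A i))).
    apply: closed_range => x y.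
    by rewrite -(star_homN star_hom_incl) -(star_homD star_hom_incl) nrm_incl.
  apply => c /gP[_ [s sF <-] gs].
  have [a [t [_ _ si]]] := split_maximal sF im.
  exists (mult_incl a); first by exists a.
  by rewrite -si -ufamB; apply: le_lt_trans (nrm_ufam _ _) gs.
have [t tF gt] : span_on F' (g - iota_ a).
  apply: cF' => c c0; have c2 : 0 < c / 2 by rewrite divr_gt0.
  have [_ [s sF <-] gs] := gP _ c2.
  have [b [t [tF sE si]]] := split_maximal sF im.
  exists (ev iota_ t); first by exists t.
  have ab : nrm (b - a) < c / 2.
    rewrite -nrm_incl (star_homD star_hom_incl) (star_homN star_hom_incl) ga -si.
    rewrite -ufamB; apply: le_lt_trans (nrm_ufam (ev iota_ s - g) i) _.
    by rewrite nrm_distC.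
  have -> : g - iota_ a - ev iota_ t = (g - ev iota_ s) + (iota_ b - iota_ a).
    by rewrite sE [iota_ b + ev _ _]addrC opprD !addrA subrK addrAC.
  apply: le_lt_trans (nrmD _ _) _.
  by rewrite iota_dist [ltRHS]splitr ltrD.
exists (Tagged A a :: t) => [j|]; last by rewrite ev_cons gt addrC subrK.
rewrite inE => /orP[/eqP->//|/tF].
by rewrite mem_filter => /andP[].
Qed.

Lemma span_on_sub F : (forall i j, i \in F -> j \in F -> (i `&` j)%O \in F) ->
  sub_cstar (span_on F).
Proof.
move=> FI; split.
- exact: span_on_closed.
- by exists [::] => //; rewrite /ev big_nil.
- move=> _ _ [s sF <-] [t tF <-]; exists (s ++ t); last exact: ev_cat.
  by move=> i; rewrite map_cat mem_cat => /orP[/sF|/tF].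
- move=> a _ [s sF <-]; exists (fscale a s); last exact: ev_scale iota_hom _ _.
  by move=> i; rewrite /fscale -map_comp; exact: sF.
- move=> _ _ [s sF <-] [t tF <-]; exists (fmul hprod s t); last exact: ev_mul iotaM.
  move=> i /mapP[_ /allpairsP[[p q] /= [ps qt ->]] ->] /=.
  by apply: FI; [apply: sF | apply: tF]; apply/mapP; [exists p | exists q].
- move=> _ [s sF <-]; exists (fstar s); last exact: ev_star iota_hom _.
  by move=> i; rewrite /fstar -map_comp; exact: sF.
Qed.

Lemma fsbig_uniq (V : nmodType) (S : L -> V) (F : seq L) : uniq F ->
  (forall i, i \notin F -> S i = 0) -> \sum_(i \in [set: L]) S i = \sum_(i <- F) S i.
Proof.
move=> uF SF; rewrite (fsbig_seq _ _ uF); apply/esym/fsbig_widen => //.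
by move=> i [_ /= /negP]; exact: SF.
Qed.

Lemma range_sub i : sub_cstar (range (@iota_ i)).
Proof.
have H := iota_hom i; split.
- by apply: closed_range; exact: iota_dist.
- by exists 0 => //; exact: star_hom0.
- by move=> _ _ [a _ <-] [b _ <-]; exists (a + b) => //; exact: star_homD.
- by move=> c _ [a _ <-]; exists (c *: a) => //; exact: star_homZ.
- by move=> _ _ [a _ <-] [b _ <-]; exists (a ** b) => //; exact: star_homM.
- by move=> _ [a _ <-]; exists (star a) => //; exact: star_homS.
Qed.

(** At a maximal index of the support, the coordinate is the component itself. *)
Lemma range_indep (S : L -> galg) : (forall i, range (@iota_ i) (S i)) ->
  finite_set [set i | S i != 0] -> \sum_(i \in [set: L]) S i = 0 ->
  forall i, S i = 0.
Proof.
move=> Si /finite_seqP[F0 SF0]; pose F := undup F0.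
have SF i : (i \in F) = (S i != 0).
  rewrite mem_undup; have := congr1 (fun X : set L => X i) SF0.
  by move=> /= E; apply/idP/idP; [rewrite -E | move=> Sn; rewrite -E].
rewrite (@fsbig_uniq _ S F) ?undup_uniq//; last first.
  by move=> i; rewrite SF negbK => /eqP.
move=> S0 i; apply/eqP/negPn; rewrite -SF; apply/negP => iF.
have /ex_maximal[k kF km] : F != [::] by apply: contraTneq iF => ->.
have [a _ ak] := Si k.
have := congr1 (fun g : galg => g k) S0; rewrite ufam_sum.
rewrite (bigD1_seq k) ?undup_uniq//= big_seq_cond big1 => [|j /andP[jF jk]].
  rewrite -ak addr0 [LHS]coord_id -[RHS](star_hom0 star_hom_incl) => /incl_inj a0.
  by move: kF; rewrite SF -ak a0 (star_hom0 (iota_hom k)) eqxx.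
have [b _ <-] := Si j; apply: coord_nle; apply/negP => /(km _ jF) /eqP.
by rewrite (negPf jk).
Qed.

Lemma range_total : dense (linear_span (\bigcup_i range (@iota_ i))).
Proof.
move=> O [g Og] oO.
have /nbhs_nrm[c c0 cO] : nbhs g O by exact: open_nbhs_nbhs.
have [s gs] := galg_dense g c0; exists (ev iota_ s); split; first exact: cO.
pose p (n : 'I_(size s)) := tnth (in_tuple s) n.
exists (size s), (fun=> 1), (fun n => iota_ (tagged (p n))).
split; first by move=> n; exists (tag (p n)) => //; exists (tagged (p n)).
by rewrite /ev big_tnth; apply: eq_bigr => n _; rewrite scale1r.
Qed.

Lemma range_mul i j x y : range (@iota_ i) x -> range (@iota_ j) y ->
  range (@iota_ (i `&` j)%O) (x ** y).
Proof.
move=> [a _ <-] [b _ <-]; rewrite (iotaM (Tagged A a) (Tagged A b)).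
by exists (tagged (hprod (Tagged A a) (Tagged A b))).
Qed.

Definition graded_galg : gradedCStarAlg R L :=
  GradedCStarAlg range_sub range_indep range_total range_mul.

Definition galg_id : identification A graded_galg :=
  @Identification R d L A graded_galg iota_ iota_hom iota_inj (fun=> erefl).

(** The index j `&` i of the product equals i, but not by conversion. *)
Let coord_action m i j k (hij : (i <= j)%O) (hj : (k <= j)%O) (hi : (k <= i)%O)
    (x : A i) (y : A j) (z : A k) :
  k = i -> phi hj y ** phi hi x = mult_incl z ->
  coord m z = coord m (lmult (phi hij y) x).
Proof.
move=> ki; subst k; rewrite (Prop_irrelevance hi (lexx i)) phi_id mult_mul_incl.
by move=> /incl_inj <-; rewrite (Prop_irrelevance hj hij).
Qed.

Lemma galg_structure : structure_morphisms galg_id (@phi).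
Proof.
move=> i j hij x y; apply: uclosure_ext => m /=.
apply/esym; rewrite [LHS](coordM m (Tagged A y) (Tagged A x)).
apply: (coord_action m hij _ (hprodP (Tagged A y) (Tagged A x))).
exact/meet_idPr.
Qed.

Section GradedSums.
Context (G : gradedCStarAlg R L) (e : identification A G).

Lemma emb_eq0 s : ev (emb e) s = 0 <-> forall i, coef s i = 0.
Proof.
split=> [s0 i|]; last exact: (ev_eq0_coef (emb_hom e)).
have uF := undup_uniq [seq tag p | p <- s].
have sF : {subset [seq tag p | p <- s] <= undup [seq tag p | p <- s]}.
  by move=> j; rewrite mem_undup.
apply: (@emb_inj _ _ _ _ _ e); rewrite (star_hom0 (emb_hom e i)).
have cF j : j \notin undup [seq tag p | p <- s] -> e j (coef s j) = 0.
  rewrite mem_undup => js; rewrite /coef big_seq big1 ?(star_hom0 (emb_hom e j))// => p ps.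
  apply: tagged_as_ne; apply: contraNneq js => ->; exact: map_f.
apply: (component_indep (S := fun j => e j (coef s j))).
- by move=> j; rewrite -(emb_range e j); exists (coef s j).
- apply: (sub_finite_set (B := [set` undup [seq tag p | p <- s]])) => //.
  by move=> j /=; apply: contraNT => /cF ->.
- by rewrite (fsbig_uniq uF cF) -(ev_coef (emb_hom e) uF sF).
Qed.

Lemma emb_dense (g : G) (c : R) : 0 < c -> exists s, nrm (g - ev (emb e) s) < c.
Proof.
move=> c0; pose O := [set y | nrm (g - y) < c].
have gO : nbhs g O by apply/nbhs_nrm; exists c.
have [x [/interior_subset Ox [n [a [v [vP xE]]]]]] :
    (O^° `&` linear_span (\bigcup_i component G i)) !=set0.
  by apply: component_total (open_interior O); exists g.
have {vP} vP r : exists p, v r = e _ (tagged p).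
  have [i _] := vP r; rewrite -(emb_range e i) => -[b _ <-].
  by exists (Tagged A b).
exists [seq Tagged A (a r *: tagged (projT1 (cid (vP r)))) | r <- index_enum 'I_n].
rewrite /ev big_map; move: Ox; rewrite xE /O /=; congr (nrm (_ - _) < _).
apply: eq_bigr => r _ /=; rewrite (star_homZ (emb_hom e _)).
by rewrite {1}(projT2 (cid (vP r))).
Qed.

End GradedSums.

Section Uniqueness.
Context (G : gradedCStarAlg R L) (e : identification A G).
Hypothesis eS : structure_morphisms e (@phi).

(** The structure morphisms determine the product of two components, since an
element of A_(i /\ j) is determined by its action on A_(i /\ j). *)
Lemma emb_mul p q : e _ (tagged p) ** e _ (tagged q) = e _ (tagged (hprod p q)).
Proof.
have cr i (a : A i) : component G i (e i a) by rewrite -(emb_range e i); exists a.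
have := component_mul (cr _ (tagged p)) (cr _ (tagged q)).
rewrite -(emb_range e) => -[z _ zE].
rewrite -zE; congr (e _ _); apply: smul_inj_r => t; apply: (@emb_inj _ _ _ _ _ e).
rewrite (star_homM (emb_hom e _)) zE -smulA -(eS (leIr _ _)) -(eS (leIl _ _)).
by rewrite -[lmult _ (lmult _ t)]/(lmult (_ ** _) t) hprodP.
Qed.

(** The degrees occurring in s generate a finite subsemilattice, over which the
formal sums form a closed subalgebra of the constructed algebra. On it, the
correspondence of formal sums is an injective star homomorphism into G, hence
isometric. *)
Lemma emb_isometric s : nrm (ev (emb e) s) = nrm (ev iota_ s).
Proof.
pose P := span_on (meets [seq tag p | p <- s]).
have PP : sub_cstar P by apply: span_on_sub; exact: meets_closed.
have eH := emb_hom e.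
(* Both kernels consist of the formal sums all of whose coefficients vanish. *)
have ker u : ev (emb e) u = 0 <-> ev iota_ u = 0.
  by rewrite emb_eq0 -(emb_eq0 galg_id).
have sub0 (V : starAlgType R[i]) (E : forall i, A i -> V) u v :
    (forall i, star_hom (@E i)) -> ev E (u ++ fscale (-1) v) = ev E u - ev E v.
  by move=> EH; rewrite ev_cat (ev_scale EH) scaleN1r.
have wd u v : ev iota_ u = ev iota_ v -> ev (emb e) u = ev (emb e) v.
  move=> uv; apply/eqP; rewrite -subr_eq0 -sub0//; apply/eqP/ker.
  by rewrite sub0 ?uv ?subrr//; exact: iota_hom.
pose rep g : seq homog :=
  if pselect (exists u, g = ev iota_ u) is left h then projT1 (cid h) else [::].
have repE u : ev iota_ (rep (ev iota_ u)) = ev iota_ u.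
  rewrite /rep; case: pselect => [h|[]]; last by exists u.
  by rewrite -(projT2 (cid h)).
pose f g := ev (emb e) (rep g).
have fE u : f (ev iota_ u) = ev (emb e) u by apply: wd; exact: repE.
have fH : star_hom_on P f.
  split=> [_ _ [u _ <-] [v _ <-]|a _ [u _ <-]|_ _ [u _ <-] [v _ <-]|_ [u _ <-]].
  - by rewrite -ev_cat !fE ev_cat.
  - by rewrite -(ev_scale iota_hom) !fE (ev_scale eH).
  - by rewrite -(ev_mul _ _ iotaM) !fE (ev_mul _ _ emb_mul).
  - by rewrite -(ev_star iota_hom) !fE (ev_star eH).
have Ps : P (ev iota_ s) by exists s => //; exact: sub_meets.
rewrite -fE; apply/eqP; rewrite eq_le (hom_contractive PP fH Ps)/=.
apply: (injective_hom_ge PP fH) => // _ [u _ <-].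
by rewrite fE => /ker.
Qed.

Lemma galg_unique : exists f : graded_galg -> G,
  star_iso f /\ forall i (x : A i), f (galg_id i x) = e i x.
Proof.
have eH := emb_hom e.
have [|||||||||f [f_iso fE]] := @dense_star_iso R _ galg G (ev iota_) (ev (emb e))
    (fun a s t => fscale a s ++ t) (fmul hprod) fstar.
- move=> s t.
  rewrite -[- ev (emb e) t]scaleN1r -[- ev iota_ t]scaleN1r.
  rewrite -(ev_scale eH) -(ev_scale iota_hom) -!ev_cat.
  exact: emb_isometric.
- exact: galg_dense.
- exact: emb_dense.
- by move=> a s t; rewrite ev_cat (ev_scale iota_hom).
- by move=> a s t; rewrite ev_cat (ev_scale eH).
- by move=> s t; exact: ev_mul iotaM.
- by move=> s t; exact: ev_mul emb_mul.
- by move=> s; exact: ev_star iota_hom _.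
- by move=> s; exact: ev_star eH _.
exists f; split => // i x.
by have := fE [:: Tagged A x]; rewrite /ev !big_seq1.
Qed.

End Uniqueness.

End Construction.

Unset Implicit Arguments.
Set Strict Implicit.
Close Scope complex_scope.
Close Scope classical_set_scope.

Theorem mainTheorem1 (R : realType) (d : Order.disp_t)
    (L : meetSemilatticeType d) (A : L -> cstarAlgType R)
    (phi : forall i j : L, (i <= j)%O -> A j -> multiplier (A i))
    (phi_hom : forall (i j : L) (hij : (i <= j)%O), star_hom (phi i j hij))
    (phi_id : forall (i : L) (x : A i), phi i i (lexx i) x = mult_incl x)
    (phi_mul : forall (i j m : L) (hm : (m <= i `&` j)%O) (x : A i) (y : A j),
       exists2 z : A (i `&` j)%O,
         phi (i `&` j)%O i (leIl i j) x ** phi (i `&` j)%O j (leIr j i) y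
           = mult_incl z
         & phi m (i `&` j)%O hm z
           = phi m i (le_trans hm (leIl i j)) x
             ** phi m j (le_trans hm (leIr j i)) y) :
  exists (G : gradedCStarAlg R L) (e : identification A G),
    structure_morphisms e phi /\
    forall (G' : gradedCStarAlg R L) (e' : identification A G'),
      structure_morphisms e' phi ->
      exists f : G -> G',
        star_iso f /\ forall (i : L) (x : A i), f (e i x) = e' i x.
Proof.
exists (graded_galg phi_hom phi_id phi_mul), (galg_id phi_hom phi_id phi_mul).
split; first exact: galg_structure.
by move=> G' e' eS; exact: galg_unique eS.
Qed.
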